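(* Let $H$ be a generalized hexagon of order $(2,8)$, and let $L_H$ be the lattice constructed from its rank-$26$ Bose--Mesner idempotent $E$ as in the context. Then $L_H$ is an even integral lattice with $$\operatorname{rk}L_H=26,\qquad \det L_H=3,\qquad \min L_H=4.$$ The shortest vectors in one non-zero class of $L_H^\#/L_H$ recover $H$: the geometry whose points are the vectors of minimal norm in that class and whose lines are the triples $\{x,y,z\}$ of such vectors with $x+y+z=0$ is a generalized hexagon isomorphic to $H$.
   Context: A generalized hexagon is a point-line incidence geometry whose incidence graph has diameter $6$ and girth $12$; it has order $(s,t)$ if every line contains $s+1$ points and every point lies on $t+1$ lines. Let $X$ be the point set of $H$ (it has $819$ elements). The point graph has vertex set $X$, two distinct points being adjacent when they are collinear; it has diameter $3$. Let $A_i$ ($i=1,2,3$) be the $0/1$-matrix indexed by $X\times X$ recording pairs at distance $i$ in the point graph, and $I$ the identity. The matrices $I,A_1,A_2,A_3$ span the Bose--Mesner algebra of a three-class association scheme, and its primitive idempotent of rank $26$ is $$E=\tfrac{2}{63}\left(I-\tfrac12A_1+\tfrac14A_2-\tfrac18A_3\right).$$ With $e_x$ the standard coordinate vectors of $\mathbf R^X$ (standard inner product), put $v_x=\sqrt{84}\,Ee_x$. Thus $(v_x,v_y)=8/3,-4/3,2/3,-1/3$ according as $x,y$ are at distance $0,1,2,3$. Let $\Lambda=\langle v_x:x\in X\rangle_{\mathbf Z}$, a lattice of rank $26$, and $$L_H=\Big\{\sum_{x\in X}a_xv_x:\ a_x\in\mathbf Z,\ \sum_{x}a_x\equiv0\pmod3\Big\}\subset\Lambda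 .$$ The norm of $v$ is $(v,v)$; a lattice is even if all norms are even integers; $\det$ is the Gram determinant, $\min$ the smallest norm of a non-zero vector, and $L^\#$ the dual lattice. Classes of $L_H^\#/L_H$ are regarded as cosets. *)

(* Defs.v *)
From HB Require Import structures.
From mathcomp Require Import all_boot all_order all_algebra.
From mathcomp Require Import finmap boolp classical_sets reals.

Set Implicit Arguments.
Unset Strict Implicit.
Unset Printing Implicit Defensive.

Import Order.TTheory GRing.Theory Num.Theory.
Local Open Scope classical_set_scope.
Local Open Scope ring_scope.

Section Graphs.
Variables (T : eqType) (e : rel T).

Definition graph_dist (x y : T) (n : nat) : Prop :=
  (exists p, [/\ path e x p, last x p = y & size p = n]) /\
  (forall p, path e x p -> last x p = y -> (n <= size p)%N).

Definition graph_diameter (d : nat) : Prop :=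
  (forall x y, exists2 n, graph_dist x y n & (n <= d)%N) /\
  (exists x y, graph_dist x y d).

(* The bound on the size excludes back-and-forth walks along one edge, which
   [ucycle] accepts. *)
Definition graph_girth (g : nat) : Prop :=
  (exists c, [/\ ucycle e c, (2 < size c)%N & size c = g]) /\
  (forall c, ucycle e c -> (2 < size c)%N -> (g <= size c)%N).

End Graphs.

Section Geometry.
Variables (X Y : eqType) (inc : X -> Y -> bool).

Definition incidence_graph : rel (X + Y)%type := fun u v =>
  match u, v with
  | inl x, inr l => inc x l
  | inr l, inl x => inc x l
  | _, _ => false
  end.

Definition generalized_hexagon : Prop :=
  graph_diameter incidence_graph 6 /\ graph_girth incidence_graph 12.

End Geometry.

Definition geometry_iso (X Y X' Y' : eqType)
    (inc : X -> Y -> bool) (inc' : X' -> Y' -> bool) : Prop :=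
  exists (f : X -> X') (g : Y -> Y'),
    [/\ bijective f, bijective g & forall x l, inc' (f x) (g l) = inc x l].

Definition has_order (X Y : finType) (inc : X -> Y -> bool) (s t : nat) : Prop :=
  (forall l, #|[pred x | inc x l]| = s.+1) /\
  (forall x, #|[pred l | inc x l]| = t.+1).

Section Lattices.
Variables (R : realType) (n : nat).
Implicit Types (L C M : set 'cV[R]_n) (u v w : 'cV[R]_n).

Definition dot u v : R := \sum_i u i 0 * v i 0.
Definition sqnorm u : R := dot u u.

(* The columns of [B] are linearly independent over [R] and generate [L] over
   the integers. *)
Definition lattice_basis L (r : nat) (B : 'M[R]_(n, r)) : Prop :=
  \rank B = r /\ L = [set B *m map_mx intr z | z in [set: 'cV[int]_r]].

Definition lattice_rank L (r : nat) : Prop :=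
  exists B : 'M[R]_(n, r), lattice_basis L B.

Definition lattice_det L (d : R) : Prop :=
  (exists r (B : 'M[R]_(n, r)), lattice_basis L B) /\
  (forall r (B : 'M[R]_(n, r)), lattice_basis L B -> \det (B^T *m B) = d).

Definition lattice_min L (m : R) : Prop :=
  (exists u, [/\ L u, u <> 0 & sqnorm u = m]) /\
  (forall u, L u -> u <> 0 -> m <= sqnorm u).

Definition is_integral L : Prop :=
  forall u v, L u -> L v -> exists k : int, dot u v = k%:~R.

Definition is_even L : Prop :=
  forall u, L u -> exists k : int, sqnorm u = (2 * k)%:~R.

Definition real_span L : set 'cV[R]_n :=
  [set w | exists (m : nat) (c : 'I_m -> R) (u : 'I_m -> 'cV[R]_n),
     (forall i, L (u i)) /\ w = \sum_i c i *: u i].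

(* [L] need not have full rank, so its dual is taken inside its real span. *)
Definition dual_lattice L : set 'cV[R]_n :=
  [set w | real_span L w /\ forall u, L u -> exists k : int, dot w u = k%:~R].

Definition dual_class L C : Prop :=
  exists2 w, dual_lattice L w & C = [set w + u | u in L].

Definition minimal_vectors C : set 'cV[R]_n :=
  [set u | C u /\ forall v, C v -> sqnorm u <= sqnorm v].

(* The geometry attached to a set [M] of vectors: its points are the elements
   of [M], its lines the three-element subsets of [M] with sum zero. *)
Definition vector_point M : eqType := {u : 'cV[R]_n | u \in M}.

Definition vector_line M : eqType :=
  {l : {fset 'cV[R]_n} |
     [&& #|` l| == 3%N, all (fun u => u \in M) l & \sum_(u <- l) u == 0]}.

Definition vector_inc M (p : vector_point M) (l : vector_line M) : bool :=
  sval p \in sval l.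

End Lattices.

Section HexagonLattice.
Variables (R : realType) (X Y : finType) (inc : X -> Y -> bool).

Definition collinear : rel X :=
  fun x y => (x != y) && [exists l, inc x l && inc y l].

(* Rows and columns are indexed by [X] through its enumeration. *)
Definition dist_mx (i : nat) : 'M[R]_#|X| :=
  \matrix_(a, b) (`[< graph_dist collinear (enum_val a) (enum_val b) i >])%:R.

(* If the geometry is a generalized hexagon of order (2, 8), this is the
   primitive idempotent of rank 26 of the Bose-Mesner algebra of the point
   graph. *)
Definition idem26 : 'M[R]_#|X| :=
  (2 / 63) *: (1%:M - (1 / 2) *: dist_mx 1 + (1 / 4) *: dist_mx 2
               - (1 / 8) *: dist_mx 3).

(* Scaled so that the inner products are 8/3, -4/3, 2/3, -1/3 at distances
   0, 1, 2, 3 in the point graph. *)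
Definition hexagon_vector (x : X) : 'cV[R]_#|X| :=
  Num.sqrt 84 *: (idem26 *m delta_mx (enum_rank x) 0).

Definition hexagon_lattice : set 'cV[R]_#|X| :=
  [set u | exists a : X -> int,
     (3 %| \sum_x a x)%Z /\ u = \sum_x hexagon_vector x *~ a x].

End HexagonLattice.

Arguments hexagon_lattice R {X Y} inc.

(* Main.v *)
(* For u in the span of the v_x put c_x = (u, v_x) and N = (u, u). The kernel
   g(x, y) = (v_x, v_y) satisfies g^2 = 84 g, and since the v_x form a spherical
   design for quartic harmonics,
     sum_x c_x^2 = 84 N,   sum_x c_x^4 = 24 N^2,
   with polarized versions. If all c_x are integers, then
   sum_x (c_x^4 - c_x^2) / 12 = 2 N^2 - 7 N >= 0, so N = 0 or N >= 7/2; as L is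
   even, its minimum is 4.

   For the determinant, let u have integral c_x and be shortest modulo L. Then
   |c_x| <= 2, an entry 2 leads to an inconsistent system of counts, and
   otherwise 2 N^2 = 7 N. So every class outside L of the dual M of the lattice
   generated by the v_x has norm 7/2 modulo 2, which forces M / L to have order
   at most 2. Order 2 is impossible: adjoining a vector of norm 4 that projects
   onto such a class would produce an even lattice of odd rank 27 with odd
   determinant. Hence M = L, and L together with v_x + s, where s is orthogonal
   to L and (s, s) = 1/3, is unimodular of rank 27; so det L = 3.

   In the class v_x + L the norms are 8/3 modulo 2, the norm 2/3 is too small for
   the congruences c_y = 2/3 mod 1, and a vector of norm 8/3 that is no v_y
   would have all entries in {-4/3, -1/3, 2/3}, contradicting the moments. *)

Require Import Defs.
From HB Require Import structures.
From mathcomp Require Import all_boot all_order all_algebra.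
From mathcomp Require Import finmap boolp classical_sets reals.
From mathcomp Require Import ring lra zify.

Set Implicit Arguments.
Unset Strict Implicit.
Unset Printing Implicit Defensive.

Import Order.TTheory GRing.Theory Num.Theory.
Local Open Scope classical_set_scope.
Local Open Scope ring_scope.

(** * Distances in the incidence graph *)

(** All numerical input comes from lines. Seen from a point [z], a line has one nearest point and
    two points one step further, and the inner products are [8 / 3] times powers of [- 1 / 2], so
    they sum to zero on every line. A function with zero line sums has its sum over each shell
    around [z] fixed by its value at [z]; the shell sizes, the relation for [g^2] and the power sums
    of [g] follow from this. The quartic identity is obtained from a tensor measuring its failure:
    both terms of that tensor are orthogonal to the tensor itself, so its norm is zero. The constant
    24 is [3 * 8], one 8 for each way of pairing four arguments. The norm [7 / 2] solves the moment
    equation [2 N^2 = 7 N], which is why the determinant needs a parity argument besides the counts.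
    Adjoined vectors are never constructed: an integral matrix [A] bordering the Gram matrix stands
    for the larger lattice, and an integral [Z] with [A Z = mu I] stands for the statement that [mu]
    kills its discriminant group. Comparing determinants then gives [det A * det Z = mu^27], with
    [mu = 3] for the parity argument and [mu = 1] for unimodularity. *)

Section GraphDistance.
Variables (T : finType) (e : rel T).
Hypothesis e_sym : symmetric e.
Variable D : nat.
Hypothesis diamD : forall x y, exists2 n, graph_dist e x y n & (n <= D)%N.

Lemma graph_dist_functional x y m n :
  graph_dist e x y m -> graph_dist e x y n -> m = n.
Proof.
move=> [[p [pp lp <-]] minp] [[q [pq lq <-]] minq].
by apply/eqP; rewrite eqn_leq minp // minq.
Qed.

Definition gdist x y : nat := s2val (cid2 (diamD x y)).

Lemma gdistP x y : graph_dist e x y (gdist x y).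
Proof. exact: s2valP (cid2 (diamD x y)). Qed.

Lemma gdist_le_diam x y : (gdist x y <= D)%N.
Proof. exact: s2valP' (cid2 (diamD x y)). Qed.

Lemma gdist_path x p : path e x p -> (gdist x (last x p) <= size p)%N.
Proof. by move=> pp; apply: (gdistP x (last x p)).2. Qed.

Lemma gdist_geodesic x y :
  exists p, [/\ path e x p, last x p = y & size p = gdist x y].
Proof. exact: (gdistP x y).1. Qed.

Lemma gdist0 x : gdist x x = 0%N.
Proof. by apply/eqP; rewrite -leqn0; apply: (@gdist_path x [::]). Qed.

Lemma gdist_eq0 x y : (gdist x y == 0%N) = (x == y).
Proof.
apply/eqP/eqP => [d0|->]; last exact: gdist0.
by have [p [_ lp]] := gdist_geodesic x y; rewrite d0 -lp => /size0nil ->.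
Qed.

Lemma gdist_sym x y : gdist x y = gdist y x.
Proof.
suff le_d u v : (gdist v u <= gdist u v)%N by apply/eqP; rewrite eqn_leq !le_d.
have [p [pp lp <-]] := gdist_geodesic u v.
have rp : path e v (rev (belast u p)).
  by rewrite -lp rev_path (eq_path (e' := e)).
have lr : last v (rev (belast u p)) = u.
  by case: p {pp} lp rp => //= a p _ _; rewrite rev_cons last_rcons.
by have := gdist_path rp; rewrite lr size_rev size_belast.
Qed.

Lemma gdist_triangle y x z : (gdist x z <= gdist x y + gdist y z)%N.
Proof.
have [p [pp lp <-]] := gdist_geodesic x y.
have [q [pq lq <-]] := gdist_geodesic y z.
have := @gdist_path x (p ++ q); rewrite cat_path last_cat lp lq size_cat pp pq.
exact.
Qed.

Lemma gdist_edge x y : e x y -> (gdist x y <= 1)%N.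
Proof. by move=> xy; apply: (@gdist_path x [:: y]); rewrite /= xy. Qed.

Lemma gdist_step x y z : e y z -> (gdist x z <= (gdist x y).+1)%N.
Proof.
by move=> yz; rewrite (leq_trans (gdist_triangle y x z)) // -addn1 leq_add2l gdist_edge.
Qed.

Lemma gdist_pred x y n : gdist x y = n.+1 -> exists2 z, e z y & gdist x z = n.
Proof.
have [p [pp lp sp]] := gdist_geodesic x y => dn.
case/lastP: p pp lp sp => [|p z]; first by rewrite dn.
rewrite rcons_path last_rcons size_rcons dn => /andP[pp ez] zy [sp].
exists (last x p); first by rewrite -zy.
have := gdist_path pp; have := @gdist_step x _ _ ez.
by rewrite zy dn sp ltnS => le1 le2; apply/eqP; rewrite eqn_leq le1 le2.
Qed.

Lemma geodesic_levels x p : path e x p -> size p = gdist x (last x p) ->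
  map (gdist x) p = iota 1 (size p).
Proof.
elim/last_ind: p => //= p z IH; rewrite rcons_path last_rcons size_rcons.
move=> /andP[pp ez] sp; rewrite map_rcons -[(size p).+1]addn1 iotaD cats1 add1n sp; congr rcons.
apply: IH => //; apply/eqP; rewrite eqn_leq gdist_path // andbT.
by have := @gdist_step x _ _ ez; rewrite -sp ltnS.
Qed.

Lemma geodesic_suffix x p z : path e x p -> size p = gdist x (last x p) ->
  z \in p -> gdist x (last x p) = (gdist x z + gdist z (last x p))%N.
Proof.
move=> pp sp zp; apply/eqP; rewrite eqn_leq gdist_triangle /=.
have := geodesic_levels pp sp.
case/splitPr: zp pp sp => p1 p2; rewrite cat_path last_cat size_cat /=.
move=> /and3P[pp1 _ pp2] <- lev; rewrite addnS -addSn.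
have <-: nth 0%N (map (gdist x) (p1 ++ z :: p2)) (size p1) = (size p1).+1.
  by rewrite lev nth_iota ?size_cat /= ?addnS ?ltnS ?leq_addr // add1n.
rewrite map_cat nth_cat size_map ltnn subnn /=.
by rewrite leq_add2l gdist_path.
Qed.

Variable g : nat.
Hypothesis girthg : graph_girth e g.

(* Geodesics from [x] to two different such neighbours either share an interior
   vertex, which can replace [x], or close up to a circuit of length [2 (n + 1)]. *)
Lemma closer_neighbour_unique n x y a b : (n.+1.*2 < g)%N ->
    gdist x y = n.+1 -> e a y -> e b y ->
  gdist x a = n -> gdist x b = n -> a = b.
Proof.
elim/ltn_ind: n x => n IH x ng dy ay yb da db.
have [p [pp lp sp]] := gdist_geodesic x a.
have [q [pq lq sq]] := gdist_geodesic x b.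
have levp := geodesic_levels pp; rewrite lp -sp in levp.
have levq := geodesic_levels pq; rewrite lq -sq in levq.
have {levp}levp := levp erefl; have {levq}levq := levq erefl.
have uniqp : uniq p by apply: (@map_uniq _ _ (gdist x)); rewrite levp iota_uniq.
have uniqq : uniq q by apply: (@map_uniq _ _ (gdist x)); rewrite levq iota_uniq.
have gt0 z r : z \in r -> map (gdist x) r = iota 1 (size r) ->
    (0 < gdist x z <= size r)%N.
  move=> zr levr; have := map_f (gdist x) zr; rewrite levr mem_iota.
  by rewrite add1n ltnS.
case: (boolP (has [in p] q)) => [/hasP[z zq zp]|disj].
  have dza : gdist x a = (gdist x z + gdist z a)%N.
    by rewrite -lp; apply: geodesic_suffix; rewrite ?lp.
  have dzb : gdist x b = (gdist x z + gdist z b)%N.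
    by rewrite -lq; apply: geodesic_suffix; rewrite ?lq.
  have /andP[z0 _] := gt0 _ _ zp levp.
  have dzy : gdist z y = (gdist z a).+1.
    apply/eqP; rewrite eqn_leq gdist_step //=.
    have := gdist_triangle z x y; rewrite dy -da dza; lia.
  apply: (IH (gdist z a) _ z) => //; lia.
have [c0 | ab] := eqVneq a b; first by [].
have nz : (0 < n)%N.
  rewrite lt0n; apply/eqP => n0; move/eqP: ab; apply.
  have /eqP : gdist x a == 0%N by rewrite da n0.
  have /eqP : gdist x b == 0%N by rewrite db n0.
  by move=> /eqP; rewrite gdist_eq0 => /eqP <- /eqP; rewrite gdist_eq0 => /eqP <-.
pose c := x :: p ++ y :: rev q.
suff : ucycle e c.
  move=> /girthg.2; rewrite /c /= size_cat /= size_rev sp sq da db.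
  by lia.
rewrite /ucycle /c /= rcons_cat cat_path pp lp /= ay /=.
have := rev_path e x (rcons q y); rewrite last_rcons belast_rcons rev_cons => ->.
rewrite (eq_path (e' := e)) // rcons_path pq lq yb /= cat_uniq /= rev_uniq uniqp uniqq.
rewrite !mem_cat !inE !mem_rev !negb_or /= !andbT.
have xNp r : map (gdist x) r = iota 1 (size r) -> x \notin r.
  by move=> levr; apply/negP => /gt0 /(_ levr); rewrite gdist0.
have yNp r : map (gdist x) r = iota 1 (size r) -> size r = n -> y \notin r.
  by move=> levr sr; apply/negP => /gt0 /(_ levr); rewrite dy sr ltnn andbF.
have xy : x != y by rewrite -gdist_eq0 dy.
by rewrite (xNp _ levp) (xNp _ levq) (yNp _ levp) ?sp // (yNp _ levq) ?sq // has_rev disj xy.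
Qed.
End GraphDistance.

(** * The point graph and the levels of lines *)

Section Hexagon.
Variables (X Y : finType) (inc : X -> Y -> bool).
Hypothesis hexH : generalized_hexagon inc.
Hypothesis orderH : has_order inc 2 8.

Let e := incidence_graph inc.

Lemma incidence_graph_sym : symmetric e.
Proof. by move=> [x|l] [y|m]. Qed.

Let delta := gdist hexH.1.1.
Let delta_triangle v u w : (delta u w <= delta u v + delta v w)%N :=
  gdist_triangle hexH.1.1 v u w.
Let delta_sym u v : delta u v = delta v u :=
  gdist_sym incidence_graph_sym hexH.1.1 u v.
Let delta_eq0 u v : (delta u v == 0%N) = (u == v) := gdist_eq0 hexH.1.1 u v.
Let closer_unique n u v a b : (n.+1 < 6)%N -> delta u v = n.+1 ->
  e a v -> e b v -> delta u a = n -> delta u b = n -> a = b.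
Proof.
by move=> n6; apply: (closer_neighbour_unique incidence_graph_sym hexH.2); lia.
Qed.

Definition is_point (u : X + Y) := if u is inl _ then true else false.

(** The incidence graph is bipartite, so every edge changes the type of the vertex. *)
Lemma odd_delta u v : odd (delta u v) = (is_point u != is_point v).
Proof.
have [p [pp lp sp]] := gdist_geodesic hexH.1.1 u v; rewrite /delta -sp -lp => {sp lp}.
elim: p u pp => [|w p IH] u /=; first by rewrite eqxx.
by move=> /andP[uw /IH ->]; case: u w uw => [x|l] [y|m] //=; case: (is_point _).
Qed.

Definition point_dist (x y : X) : nat := (delta (inl x) (inl y))./2.

Lemma delta_points x y : delta (inl x) (inl y) = (point_dist x y).*2.
Proof. by rewrite -[LHS]odd_double_half odd_delta. Qed.

Lemma point_dist_le3 x y : (point_dist x y <= 3)%N.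
Proof.
by have := gdist_le_diam hexH.1.1 (inl x) (inl y); rewrite -/delta delta_points; lia.
Qed.

Lemma point_dist_sym x y : point_dist x y = point_dist y x.
Proof. by rewrite /point_dist delta_sym. Qed.

Lemma point_dist_eq0 x y : (point_dist x y == 0%N) = (x == y).
Proof.
have := delta_eq0 (inl x) (inl y); rewrite delta_points double_eq0 => ->.
exact: (inj_eq (@inl_inj X Y)).
Qed.

(** The incidence distance from a point to a line is odd; half of it, rounded down, is the distance
    in the point graph from [z] to the nearest point of [l]. *)
Definition line_level (z : X) (l : Y) : nat := (delta (inl z) (inr l))./2.

Lemma delta_line z l : delta (inl z) (inr l) = (line_level z l).*2.+1.
Proof. by rewrite -[LHS]odd_double_half odd_delta. Qed.

Lemma line_level_le2 z l : (line_level z l <= 2)%N.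
Proof.
by have := gdist_le_diam hexH.1.1 (inl z) (inr l); rewrite -/delta delta_line; lia.
Qed.

Lemma point_dist_incident z y l : inc y l ->
  point_dist z y = line_level z l \/ point_dist z y = (line_level z l).+1.
Proof.
move=> yl; have le1 : (delta (inl z) (inr l) <= (delta (inl z) (inl y)).+1)%N.
  exact: gdist_step.
have le2 : (delta (inl z) (inl y) <= (delta (inl z) (inr l)).+1)%N.
  exact: gdist_step.
by move: le1 le2; rewrite delta_points delta_line; lia.
Qed.

(** The distance from [z] to [l] is odd, hence at most 5 and below half the girth, so only one
    neighbour of [l] is nearer to [z]. The boolean counts the extra step to the other points. *)
Lemma nearest_point z l :
  exists2 y, inc y l & forall y', inc y' l ->
    point_dist z y' = ((y' != y) + line_level z l)%N.
Proof.
have [[y|//] /= yl dy] := gdist_pred (delta_line z l).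
have {}dy : point_dist z y = line_level z l.
  by apply: double_inj; rewrite -delta_points.
exists y => // y' y'l; have [-> //|y'y] := eqVneq y' y.
have [dy'|//] := point_dist_incident z y'l; case/eqP: y'y.
suff [] : @inl X Y y' = inl y by [].
apply: (closer_unique _ (delta_line z l)); rewrite ?delta_points ?dy ?dy' //.
by have := line_level_le2 z l; lia.
Qed.

(** The dual of [nearest_point]. Point distance 3 is excluded because it is incidence distance 6,
    where the girth no longer forces a unique nearer neighbour. *)
Lemma nearest_line z y : (0 < point_dist z y < 3)%N ->
  exists2 l, inc y l & forall l', inc y l' ->
    (line_level z l').+1 = ((l' != l) + point_dist z y)%N.
Proof.
move=> /andP[d0 d3]; have : delta (inl z) (inl y) = (point_dist z y).-1.*2.+2.
  by rewrite delta_points; lia.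
move=> /[dup] dzy /gdist_pred[[//|l] /= yl dl].
have {}dl : line_level z l = (point_dist z y).-1.
  by apply: double_inj; apply: succn_inj; rewrite -delta_line.
exists l => // l' yl'; have [->|l'l] := eqVneq l' l; first by rewrite dl; lia.
have [dy'|//] := point_dist_incident z yl'; first by rewrite dy' add1n.
move=> dy'; case/eqP: l'l.
suff [] : @inr X Y l' = inr l by [].
apply: (closer_unique _ dzy); rewrite ?delta_line ?dl ?dy' //; lia.
Qed.

Lemma line_level_opposite z y l :
  inc y l -> point_dist z y = 3 -> line_level z l = 2.
Proof.
move=> yl d3; have [] := point_dist_incident z yl; have := line_level_le2 z l; lia.
Qed.

Lemma line_level_self z l : inc z l -> line_level z l = 0%N.
Proof.
move=> zl; have d0 : point_dist z z = 0%N by apply/eqP; rewrite point_dist_eq0.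
by have [] := point_dist_incident z zl; rewrite d0.
Qed.

Lemma collinearP x y : reflect (point_dist x y = 1%N) (collinear inc x y).
Proof.
apply: (iffP andP) => [[xy /existsP[l /andP[xl yl]]]|d1].
  have := point_dist_incident x yl; rewrite line_level_self // => -[/eqP|//].
  by rewrite point_dist_eq0 (negbTE xy).
split; first by rewrite -point_dist_eq0 d1.
have := delta_points x y; rewrite d1 => /gdist_pred[[//|l] /= yl dl].
have {dl} : delta (inl x) (inr l) = 1%N by [].
move=> /gdist_pred[[x'|//] /= x'l] /eqP; rewrite delta_eq0 => /eqP[xx'].
by apply/existsP; exists l; rewrite yl xx' x'l.
Qed.

(** Two incidence steps from point to point make one collinearity step, and conversely. This
    connects the matrices [dist_mx] with [point_dist]. *)
Lemma graph_dist_collinear x y : graph_dist (collinear inc) x y (point_dist x y).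
Proof.
split.
  move: {2 3}(point_dist x y) (erefl (point_dist x y)) => n.
  elim: n y => [|n IH] y dn.
    by exists [::]; split=> //=; apply/eqP; rewrite -point_dist_eq0 dn.
  have := delta_points x y; rewrite dn doubleS => /gdist_pred[[//|l] /= yl dl].
  have {dl} : delta (inl x) (inr l) = n.*2.+1 by [].
  move=> /gdist_pred[[z|//] /= zl dz].
  have {}dz : point_dist x z = n by apply: double_inj; rewrite -delta_points.
  have [p [pp lp sp]] := IH _ dz; exists (rcons p y).
  rewrite rcons_path pp lp last_rcons size_rcons sp; split=> //=.
  apply/andP; split; last by apply/existsP; exists l; rewrite zl yl.
  by apply/eqP => zy; move: dz; rewrite zy dn; lia.
move=> p; elim: p x => [|z p IH] x /=; first by move=> _ <-; rewrite leqn0 point_dist_eq0.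
move=> /andP[/collinearP xz pp] lp; have := IH _ pp lp.
have := delta_triangle (inl z) (inl x) (inl y); rewrite -/delta !delta_points xz.
by rewrite -doubleD leq_double add1n => le1 le2; apply: leq_trans le1 _.
Qed.

Lemma graph_dist_collinearE x y i :
  `[< graph_dist (collinear inc) x y i >] = (point_dist x y == i).
Proof.
apply/asboolP/eqP => [dxy|<-]; last exact: graph_dist_collinear.
by apply: graph_dist_functional dxy; apply: graph_dist_collinear.
Qed.

Lemma exists_point : exists x : X, True.
Proof.
have [_ [[x|l] _]] := hexH.1; first by exists x.
have /card_gt0P[x _] : (0 < #|[pred x | inc x l]|)%N by rewrite orderH.1.
by exists x.
Qed.

End Hexagon.

(** * The rank 26 kernel *)

Section Kernel.
Variables (R : realType) (X Y : finType) (inc : X -> Y -> bool).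
Hypothesis hexH : generalized_hexagon inc.
Hypothesis orderH : has_order inc 2 8.

Let d := point_dist hexH.

Definition kernel (x y : X) : R := 8 / 3 * (- (1 / 2)) ^+ d x y.

Notation g := kernel.

Lemma kernel_sym x y : g x y = g y x.
Proof. by rewrite /kernel /d point_dist_sym. Qed.

Lemma kernel_diag x : g x x = 8 / 3.
Proof.
have d0 : d x x = 0%N by apply/eqP; rewrite /d point_dist_eq0.
by rewrite /kernel d0 expr0 mulr1.
Qed.

Lemma kernel_dist x y : g x y =
  nth 0 [:: 8 / 3; - (4 / 3); 2 / 3; - (1 / 3)] (point_dist hexH x y).
Proof.
rewrite /kernel -/d; have := point_dist_le3 hexH x y; rewrite -/d.
by case: (d x y) => [|[|[|[|//]]]] _ /=; field.
Qed.

Definition line_sum0 (c : X -> R) := forall l, \sum_(y | inc y l) c y = 0.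

(** The value at the nearest point is cancelled by two values that are [- (1 / 2)] times it. *)
Lemma kernel_line_sum z : line_sum0 (g z).
Proof.
move=> l; have [y yl nearest] := nearest_point hexH z l.
have cardl : #|[pred y' | inc y' l && (y' != y)]| = 2%N.
  have := orderH.1 l; rewrite (cardD1 y) inE yl add1n => -[<-].
  by apply: eq_card => y'; rewrite !inE andbC.
rewrite (bigD1 y) //= (eq_bigr (fun=> - (1 / 2) * g z y)) => [|y' /andP[y'l y'y]].
  by rewrite sumr_const cardl; field.
by rewrite /kernel /d !nearest // eqxx y'y add0n add1n exprS; field.
Qed.

Section Shells.
Variable z : X.

(** Rows of the table are levels of lines, columns are distances of [y] from [z]. At distance 0 or 3
    all nine lines through [y] have the same level; in between, one line leads back to [z] and eight
    lead away. *)
Lemma card_lines_level y k : (k <= 2)%N ->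
  #|[pred l | inc y l & line_level hexH z l == k]| =
  nth 0%N (nth [::] [:: [:: 9; 1; 0; 0]; [:: 0; 8; 1; 0]; [:: 0; 0; 8; 9]] k)%N
    (d z y).
Proof.
have cardy := orderH.2 y.
have all_lines j : (forall l, inc y l -> line_level hexH z l = j) ->
    #|[pred l | inc y l & line_level hexH z l == k]| = if j == k then 9%N else 0%N.
  move=> levj; case: eqP => [<-|jk].
    rewrite -cardy; apply: eq_card => l; rewrite !inE.
    by case: (boolP (inc y l)) => //= /levj ->; rewrite eqxx.
  apply: eq_card0 => l; rewrite !inE; case: (boolP (inc y l)) => //= /levj ->.
  exact/eqP.
have := point_dist_le3 hexH z y; rewrite -/d => d3 k2.
have [d0|d0] := posnP (d z y).
  have zy : z = y by apply/eqP; rewrite -(point_dist_eq0 hexH) -/d d0.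
  rewrite d0 (all_lines 0%N) => [|l yl]; last by rewrite zy line_level_self.
  by case: k k2 {all_lines} => [|[|[|]]].
have [d3'|d3'] := eqVneq (d z y) 3%N.
  rewrite d3' (all_lines 2%N) => [|l yl]; last exact: line_level_opposite yl d3'.
  by case: k k2 {all_lines} => [|[|[|]]].
have [|l yl lev] := @nearest_line _ _ _ hexH z y; first by rewrite -/d; lia.
have card1 : #|[pred l' | inc y l' & l' == l]| = 1%N.
  apply: (@eq_card1 _ l) => l'; rewrite !inE; case: eqP => [->|]; rewrite ?yl ?andbF //.
have card8 : #|[pred l' | inc y l' & l' != l]| = 8%N.
  move: cardy; rewrite (cardD1 l) inE yl add1n => -[<-].
  by apply: eq_card => l'; rewrite !inE andbC.
have levE l' : inc y l' -> line_level hexH z l' = ((l' != l) + (d z y).-1)%N.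
  by move=> /lev; rewrite -/d; lia.
have cardE (b : bool) :
    (forall l', inc y l' -> (line_level hexH z l' == k) = ((l' != l) == b)) ->
    #|[pred l | inc y l & line_level hexH z l == k]| = if b then 8%N else 1%N.
  move=> Eb; transitivity #|[pred l' | inc y l' & (l' != l) == b]|.
    by apply: eq_card => l'; rewrite !inE; case: (boolP (inc y l')) => //= /Eb.
  case: b Eb => _; [rewrite -card8|rewrite -card1]; apply: eq_card => l'; rewrite !inE //.
    by case: (l' == l).
  by case: (l' == l).
have [kd|kd] := eqVneq k (d z y).
  rewrite (cardE true) => [|l' /levE ->]; last by rewrite kd; case: (l' != l); lia.
  by rewrite kd; case: (d z y) d0 d3 d3' => [|[|[|[|]]]].
have [kd'|kd'] := eqVneq k.+1 (d z y).
  rewrite (cardE false) => [|l' /levE ->]; last by rewrite -kd'; case: (l' != l); lia.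
  by rewrite -kd'; case: (k) kd' k2 d3' => [|[|[|]]] // <-.
rewrite eq_card0 => [|l']; last first.
  rewrite !inE; case: (boolP (inc y l')) => //= /levE ->.
  by apply/negbTE; case: (l' != l); lia.
by move: d0 d3 d3' kd kd'; case: (d z y) => [|[|[|[|]]]] //; case: (k) k2 => [|[|[|]]].
Qed.

Definition shell (i : nat) (c : X -> R) := \sum_(y | d z y == i) c y.

Lemma shell0 c : shell 0 c = c z.
Proof. by rewrite /shell (big_pred1 z) // => y; rewrite /= /d point_dist_eq0 eq_sym. Qed.

Lemma sum_shells c : \sum_y c y = c z + shell 1 c + shell 2 c + shell 3 c.
Proof.
rewrite -(shell0 c) (partition_big (fun y => inord (d z y) : 'I_4) predT) //=.
rewrite !big_ord_recl big_ord0 addr0 !addrA /shell.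
by do 3?congr (_ + _); apply: eq_bigl => y; rewrite -val_eqE /= inordK // ltnS /d point_dist_le3.
Qed.

(* Sum [c] over the lines at level 0, 1, 2 from [z]: a point at distance 1 or 2
   lies on one line of the lower level and eight of the higher one. *)
Lemma shell_line_sum0 c : line_sum0 c ->
  [/\ shell 1 c = - 9 * c z, shell 2 c = 72 * c z & shell 3 c = - 64 * c z].
Proof.
move=> c0.
have lev k : (k <= 2)%N -> \sum_y c y *
    #|[pred l | inc y l & line_level hexH z l == k]|%:R = 0.
  move=> k2; transitivity (\sum_(l | line_level hexH z l == k) \sum_(y | inc y l) c y).
    rewrite (exchange_big_dep predT) //=; apply: eq_bigr => y _.
    rewrite sumr_const mulr_natr; congr (_ *+ _).
    by apply: eq_card => l; rewrite !inE andbC.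
  by rewrite big1 // => l _; apply: c0.
have shells (m : seq nat) k : (k <= 2)%N ->
   (forall y, #|[pred l | inc y l & line_level hexH z l == k]| = nth 0%N m (d z y)) ->
   (nth 0%N m 0)%:R * c z + (nth 0%N m 1)%:R * shell 1 c
   + (nth 0%N m 2)%:R * shell 2 c + (nth 0%N m 3)%:R * shell 3 c = 0.
  move=> k2 cardm; rewrite -[RHS](lev k k2).
  have sh i : shell i (fun y => c y *
      #|[pred l | inc y l & line_level hexH z l == k]|%:R) = (nth 0%N m i)%:R * shell i c.
    rewrite /shell mulr_sumr; apply: eq_bigr => y /eqP dy.
    by rewrite cardm dy mulrC.
  rewrite sum_shells !sh cardm mulrC.
  by have -> : d z z = 0%N by apply/eqP; rewrite /d point_dist_eq0.
have /= E0 := shells _ 0%N isT (fun y => @card_lines_level y 0 isT).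
have /= E1 := shells _ 1%N isT (fun y => @card_lines_level y 1 isT).
have /= E2 := shells _ 2%N isT (fun y => @card_lines_level y 2 isT).
by split; lra.
Qed.

(** The kernel [g z] has zero line sums and is constant on each shell around [z], so its shell sums
    give the shell sizes. *)
Lemma shell_kernel :
  [/\ shell 1 (fun=> 1) = 18, shell 2 (fun=> 1) = 288 & shell 3 (fun=> 1) = 512 :> R].
Proof.
have [] := shell_line_sum0 (kernel_line_sum z); rewrite kernel_diag /shell => E1 E2 E3.
have sh i : \sum_(y | d z y == i) g z y =
    8 / 3 * (- (1 / 2)) ^+ i * \sum_(y | d z y == i) 1.
  by rewrite mulr_sumr; apply: eq_bigr => y /eqP dy; rewrite /kernel dy mulr1.
by move: E1 E2 E3; rewrite !sh !exprS expr0 => *; split; lra.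
Qed.

(** Weighting the shell sums by the kernel values gives [84 = 8 / 3 * (1 + 9 / 2 + 18 + 8)]. *)
Lemma kernel_reproducing c : line_sum0 c -> \sum_y g z y * c y = 84 * c z.
Proof.
move=> /[dup] c0 /shell_line_sum0[E1 E2 E3].
have sh i : shell i (fun y => g z y * c y) = 8 / 3 * (- (1 / 2)) ^+ i * shell i c.
  by rewrite /shell mulr_sumr; apply: eq_bigr => y /eqP dy; rewrite /kernel dy.
rewrite sum_shells !sh kernel_diag E1 E2 E3 !exprS expr0; by field.
Qed.

Lemma sum_kernel_pow n : \sum_y g z y ^+ n = (8 / 3) ^+ n *
  (1 + 18 * (- (1 / 2)) ^+ n + 288 * (1 / 4) ^+ n + 512 * (- (1 / 8)) ^+ n).
Proof.
have [E1 E2 E3] := shell_kernel.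
have sh i : shell i (fun y => g z y ^+ n) =
    (8 / 3) ^+ n * ((- (1 / 2)) ^+ i) ^+ n * shell i (fun=> 1).
  rewrite /shell mulr_sumr; apply: eq_bigr => y /eqP dy.
  by rewrite /kernel dy mulr1 exprMn.
rewrite sum_shells !sh kernel_diag E1 E2 E3 expr1.
have -> : (- (1 / 2)) ^+ 2 = 1 / 4 :> R by field.
have -> : (- (1 / 2)) ^+ 3 = - (1 / 8) :> R by field.
by ring.
Qed.

End Shells.

Lemma card_points : #|X|%:R = 819 :> R.
Proof.
have [z _] := exists_point hexH orderH.
have [E1 E2 E3] := shell_kernel z.
rewrite -sum1_card natr_sum (sum_shells z) E1 E2 E3; ring.
Qed.

End Kernel.

Lemma psum_eq0 (R : realDomainType) (I : finType) (f : I -> R) :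
  (forall i, 0 <= f i) -> \sum_i f i = 0 -> forall i, f i = 0.
Proof.
move=> f0 /eqP; rewrite psumr_eq0 // => /allP f00 i.
by apply/eqP; apply: f00; rewrite mem_index_enum.
Qed.

(** * Quartic moments of a reproducing kernel *)

Section QuarticIdentity.
Variables (R : realType) (X : finType) (g : X -> X -> R).
Hypothesis g_sym : forall x y, g x y = g y x.
Hypothesis g_diag : forall x, g x x = 8 / 3.

Definition reproducing (c : X -> R) := forall z, \sum_y g z y * c y = 84 * c z.

Hypothesis g_rep : forall z, reproducing (g z).
Hypothesis g_card : #|X|%:R = 819 :> R.
Hypothesis g_pow4 : forall z, \sum_y g z y ^+ 4 = 24 * (8 / 3) ^+ 2.

(** The factor [1 / 84] makes [g z] represent evaluation at [z]. On coefficient functions of vectors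
    it becomes the inner product of the vectors, see [dot_coef]. *)
Definition ip (a b : X -> R) : R := (\sum_x a x * b x) / 84.

Lemma ipC a b : ip a b = ip b a.
Proof. by rewrite /ip; congr (_ / _); apply: eq_bigr => x _; rewrite mulrC. Qed.

Lemma ip_kernel z c : reproducing c -> ip (g z) c = c z.
Proof. by move=> rc; rewrite /ip rc; field. Qed.

Definition quartic_defect (a b c d : X -> R) : R :=
  \sum_x a x * b x * c x * d x
  - 8 * (ip a b * ip c d + ip a c * ip b d + ip a d * ip b c).

Notation Q := quartic_defect.

Lemma quartic_defectC a b c d : Q a b c d = Q b a c d.
Proof.
rewrite /Q (ipC b a); congr (_ - _); last by ring.
by apply: eq_bigr => x _; ring.
Qed.

Lemma quartic_defectCA a b c d : Q a b c d = Q a c b d.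
Proof.
rewrite /Q (ipC c b); congr (_ - _); last by ring.
by apply: eq_bigr => x _; ring.
Qed.

Lemma quartic_defectAC a b c d : Q a b c d = Q a b d c.
Proof.
rewrite /Q (ipC d c); congr (_ - _); last by ring.
by apply: eq_bigr => x _; ring.
Qed.

Lemma sum_ip_kernel a b : reproducing a -> \sum_p a p * ip (g p) b = 84 * ip a b.
Proof.
move=> ra; rewrite /ip; under eq_bigr do rewrite mulrA.
rewrite -mulr_suml mulrA; congr (_ / _); under eq_bigr do rewrite mulr_sumr.
rewrite exchange_big /= mulr_sumr; apply: eq_bigr => x _.
rewrite mulrA -ra mulr_suml; apply: eq_bigr => p _.
by rewrite (g_sym x); ring.
Qed.

(** A reproducing function is a combination of the [g p], in each slot; hence the form is determined
    by its values on kernel functions. *)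
Lemma quartic_defect_expand a b c d : reproducing a ->
  \sum_p a p * Q (g p) b c d = 84 * Q a b c d.
Proof.
move=> ra; rewrite /Q.
under eq_bigr do rewrite mulrBr.
rewrite sumrB [RHS]mulrBr; congr (_ - _).
  under eq_bigr do rewrite mulr_sumr.
  rewrite exchange_big /= mulr_sumr; apply: eq_bigr => x _.
  rewrite !mulrA -ra !mulr_suml; apply: eq_bigr => p _.
  by rewrite (g_sym x); ring.
transitivity (8 * ((\sum_p a p * ip (g p) b) * ip c d +
   (\sum_p a p * ip (g p) c) * ip b d + (\sum_p a p * ip (g p) d) * ip b c)).
  rewrite !mulr_suml -!big_split mulr_sumr; apply: eq_bigr => p _ /=; ring.
by rewrite !sum_ip_kernel //; ring.
Qed.

(** Both parts of the contraction are multiples of [ip b c], and they agree because [84 * (8 / 3) *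
    84 = 8 * (819 * (8 / 3) + 2 * 84)]. *)
Lemma quartic_defect_trace b c : reproducing b -> reproducing c ->
  \sum_p Q (g p) (g p) b c = 0.
Proof.
move=> rb rc; rewrite /Q sumrB.
have E p : ip (g p) (g p) * ip b c + ip (g p) b * ip (g p) c + ip (g p) c * ip (g p) b
    = 8 / 3 * ip b c + 2 * (b p * c p).
  by rewrite !ip_kernel ?g_diag //; ring.
under [X in _ - X]eq_bigr do rewrite E.
rewrite -mulr_sumr big_split /= sumr_const -mulr_sumr.
have -> : \sum_p b p * c p = 84 * ip b c by rewrite /ip; field.
have -> : \sum_i \sum_x g i x * g i x * b x * c x = 84 * (8 / 3) * (84 * ip b c).
  rewrite exchange_big /=.
  have -> : 84 * ip b c = \sum_p b p * c p by rewrite /ip; field.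
  rewrite mulr_sumr; apply: eq_bigr => x _.
  rewrite -mulr_suml -mulr_suml -(g_diag x) -g_rep -mulrA; congr (_ * _).
  by apply: eq_bigr => y _; rewrite (g_sym y).
by rewrite -[_ *+ #|_|]mulr_natl g_card; field.
Qed.

(* The defect is orthogonal to every [g p q * g r s] because its trace vanishes,
   and to the fourth powers of the kernel because it vanishes on the diagonal:
   hence the sum of its squares is zero. *)
Lemma quartic_defect_kernel p q r s : Q (g p) (g q) (g r) (g s) = 0.
Proof.
pose F p q r s := Q (g p) (g q) (g r) (g s).
have diag0 x : F x x x x = 0.
  rewrite /F /Q !ip_kernel // g_diag; under eq_bigr do rewrite -!expr2 -!exprSr.
  by rewrite g_pow4; ring.
have ipg x y : ip (g x) (g y) = g x y by rewrite ip_kernel // g_sym.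
have trace r' s' : \sum_p' \sum_q' F p' q' r' s' * g p' q' = 0.
  transitivity (\sum_p' 84 * Q (g p') (g p') (g r') (g s')); last first.
    by rewrite -mulr_sumr quartic_defect_trace ?mulr0.
  apply: eq_bigr => p' _; rewrite -quartic_defect_expand //.
  by apply: eq_bigr => q' _; rewrite /F quartic_defectC mulrC.
have FC p' q' r' s' : F p' q' r' s' = F p' r' q' s' by exact: quartic_defectCA.
have FD p' q' r' s' : F p' q' r' s' = F p' s' r' q'.
  by rewrite /F quartic_defectAC quartic_defectCA quartic_defectAC.
have S1 : \sum_p' \sum_q' \sum_r' \sum_s' F p' q' r' s' * (g p' q' * g r' s') = 0.
  transitivity (\sum_r' \sum_s' (\sum_p' \sum_q' F p' q' r' s' * g p' q') * g r' s').
    under eq_bigr do rewrite exchange_big; rewrite exchange_big /=; apply: eq_bigr => r' _.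
    under eq_bigr do rewrite exchange_big; rewrite exchange_big /=; apply: eq_bigr => s' _.
    rewrite mulr_suml; apply: eq_bigr => p' _; rewrite mulr_suml; apply: eq_bigr => q' _.
    by rewrite mulrA.
  by apply: big1 => r' _; apply: big1 => s' _; rewrite trace mul0r.
have S2 : \sum_p' \sum_q' \sum_r' \sum_s' F p' q' r' s' * (g p' r' * g q' s') = 0.
  rewrite -[RHS]S1; apply: eq_bigr => p' _; rewrite exchange_big /=.
  by do 3!(apply: eq_bigr => ? _); rewrite FC.
have S3 : \sum_p' \sum_q' \sum_r' \sum_s' F p' q' r' s' * (g p' s' * g q' r') = 0.
  rewrite -[RHS]S1; apply: eq_bigr => p' _; rewrite exchange_big /=.
  under eq_bigr do rewrite exchange_big; rewrite exchange_big /=.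
  apply: eq_bigr => s' _; apply: eq_bigr => r' _; apply: eq_bigr => q' _.
  by rewrite FD (g_sym q').
have expand1 x b c d : \sum_p' g p' x * Q (g p') b c d = 84 * Q (g x) b c d.
  by rewrite -quartic_defect_expand //; apply: eq_bigr => p' _; rewrite g_sym.
(* Contracting the four slots one after another with [g _ x] turns the inner sum into [84 ^+ 4]
   times the diagonal value at [x]. *)
have S0 : \sum_p' \sum_q' \sum_r' \sum_s' F p' q' r' s' *
    (\sum_x g p' x * g q' x * g r' x * g s' x) = 0.
  have C1 p' q' r' : \sum_s' F p' q' r' s' * (\sum_x g p' x * g q' x * g r' x * g s' x)
      = \sum_x g p' x * g q' x * g r' x * (84 * Q (g x) (g p') (g q') (g r')).
    under eq_bigr do rewrite mulr_sumr.
    rewrite exchange_big /=; apply: eq_bigr => x _; rewrite -expand1 mulr_sumr.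
    apply: eq_bigr => s' _; rewrite /F quartic_defectAC quartic_defectCA quartic_defectC.
    by ring.
  have C2 p' q' : \sum_r' \sum_x g p' x * g q' x * g r' x * (84 * Q (g x) (g p') (g q') (g r'))
      = \sum_x g p' x * g q' x * (84 ^+ 2 * Q (g x) (g x) (g p') (g q')).
    rewrite exchange_big /=; apply: eq_bigr => x _; rewrite expr2 -(mulrA 84) -expand1 !mulr_sumr.
    apply: eq_bigr => r' _; rewrite quartic_defectAC quartic_defectCA quartic_defectC.
    by ring.
  have C3 p' : \sum_q' \sum_x g p' x * g q' x * (84 ^+ 2 * Q (g x) (g x) (g p') (g q'))
      = \sum_x g p' x * (84 ^+ 3 * Q (g x) (g x) (g x) (g p')).
    rewrite exchange_big /=; apply: eq_bigr => x _.
    rewrite [84 ^+ 3]exprSr -(mulrA _ 84) -expand1 !mulr_sumr.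
    apply: eq_bigr => q' _; rewrite quartic_defectAC quartic_defectCA quartic_defectC.
    by ring.
  under eq_bigr do under eq_bigr do under eq_bigr do rewrite C1.
  under eq_bigr do under eq_bigr do rewrite C2.
  under eq_bigr do rewrite C3.
  rewrite exchange_big /=; apply: big1 => x _.
  transitivity (84 ^+ 3 * (84 * Q (g x) (g x) (g x) (g x))); last first.
    by rewrite [Q _ _ _ _]diag0 !mulr0.
  rewrite -expand1 mulr_sumr; apply: eq_bigr => p' _.
  by rewrite quartic_defectAC quartic_defectCA quartic_defectC; ring.
(* One factor of the square is expanded into its definition; [S0] and [S1], [S2], [S3] dispose of
   its quartic part and of the three pairings. *)
have big0 : \sum_p' \sum_q' \sum_r' \sum_s' F p' q' r' s' ^+ 2 = 0.
  transitivity (\sum_p' \sum_q' \sum_r' \sum_s'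
     (F p' q' r' s' * (\sum_x g p' x * g q' x * g r' x * g s' x)
      - 8 * (F p' q' r' s' * (g p' q' * g r' s') + F p' q' r' s' * (g p' r' * g q' s')
             + F p' q' r' s' * (g p' s' * g q' r')))).
    do 4!(apply: eq_bigr => ? _); rewrite -!mulrDr mulrCA -mulrBr expr2.
    by congr (_ * _); rewrite /F /Q !ipg.
  under eq_bigr do under eq_bigr do under eq_bigr do rewrite sumrB -mulr_sumr !big_split /=.
  under eq_bigr do under eq_bigr do rewrite sumrB -mulr_sumr !big_split /=.
  under eq_bigr do rewrite sumrB -mulr_sumr !big_split /=.
  by rewrite sumrB -mulr_sumr !big_split /= S0 S1 S2 S3; ring.
apply/eqP; rewrite -sqrf_eq0; apply/eqP.
have F0 := psum_eq0 _ big0 p; have {}F0 := psum_eq0 _ (F0 _) q.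
have {}F0 := psum_eq0 _ (F0 _ _) r; apply: (psum_eq0 _ (F0 _ _ _) s).
all: by move=> * /=; do ?(apply: sumr_ge0 => ? _); exact: sqr_ge0.
Qed.

Lemma quartic_identity a b c d :
  reproducing a -> reproducing b -> reproducing c -> reproducing d ->
  \sum_x a x * b x * c x * d x =
  8 * (ip a b * ip c d + ip a c * ip b d + ip a d * ip b c).
Proof.
move=> ra rb rc rd; apply/eqP; rewrite -subr_eq0; apply/eqP; rewrite -/(Q a b c d).
have n84 : 84 != 0 :> R by rewrite pnatr_eq0.
have expand u v w t : reproducing u -> (forall p, Q (g p) v w t = 0) -> Q u v w t = 0.
  move=> ru Q0; apply: (mulfI n84); rewrite mulr0 -quartic_defect_expand //.
  by apply: big1 => p _; rewrite Q0 mulr0.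
apply: (expand _ _ _ _ _) => // p; rewrite quartic_defectC; apply: (expand _ _ _ _ _) => // q.
rewrite quartic_defectCA quartic_defectC; apply: (expand _ _ _ _ _) => // r.
rewrite quartic_defectAC quartic_defectCA quartic_defectC; apply: (expand _ _ _ _ _) => // s.
exact: quartic_defect_kernel.
Qed.

End QuarticIdentity.

(** * Vectors of the hexagon *)

Section Dot.
Variables (R : realType) (n : nat).
Implicit Types u v w : 'cV[R]_n.

Lemma dotC u v : dot u v = dot v u.
Proof. by apply: eq_bigr => i _; rewrite mulrC. Qed.

Lemma dotDl u v w : dot (u + v) w = dot u w + dot v w.
Proof. by rewrite -big_split; apply: eq_bigr => i _; rewrite mxE mulrDl. Qed.

Lemma dotZl a u v : dot (a *: u) v = a * dot u v.
Proof. by rewrite mulr_sumr; apply: eq_bigr => i _; rewrite mxE mulrA. Qed.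

Lemma dot0l v : dot 0 v = 0.
Proof. by rewrite -(scale0r v) dotZl mul0r. Qed.

Lemma dotNl u v : dot (- u) v = - dot u v.
Proof. by rewrite -scaleN1r dotZl mulN1r. Qed.

Lemma dotDr u v w : dot w (u + v) = dot w u + dot w v.
Proof. by rewrite dotC dotDl !(dotC w). Qed.

Lemma dotZr a u v : dot v (a *: u) = a * dot v u.
Proof. by rewrite dotC dotZl (dotC v). Qed.

Lemma dotNr u v : dot v (- u) = - dot v u.
Proof. by rewrite dotC dotNl dotC. Qed.

Lemma dotBr u v w : dot w (u - v) = dot w u - dot w v.
Proof. by rewrite dotDr dotNr. Qed.

Lemma dot_suml (I : finType) (F : I -> 'cV[R]_n) v :
  dot (\sum_i F i) v = \sum_i dot (F i) v.
Proof.
apply: (big_morph (fun u => dot u v)) => [u w|]; [exact: dotDl|exact: dot0l].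
Qed.

Lemma dot_sumr (I : finType) (F : I -> 'cV[R]_n) v :
  dot v (\sum_i F i) = \sum_i dot v (F i).
Proof. by rewrite dotC dot_suml; apply: eq_bigr => i _; rewrite dotC. Qed.

Lemma sqnorm_ge0 u : 0 <= sqnorm u.
Proof. by apply: sumr_ge0 => i _; rewrite -expr2 sqr_ge0. Qed.

Lemma sqnorm_eq0 u : sqnorm u = 0 -> u = 0.
Proof.
move=> u0; apply/matrixP => i j; rewrite ord1 mxE; apply/eqP.
rewrite -sqrf_eq0 expr2; apply/eqP; apply: (psum_eq0 _ u0 i) => k.
by rewrite -expr2 sqr_ge0.
Qed.

Lemma sqnormN u : sqnorm (- u) = sqnorm u.
Proof. by rewrite /sqnorm dotNl dotNr opprK. Qed.

Lemma sqnormD u v : sqnorm (u + v) = sqnorm u + 2 * dot u v + sqnorm v.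
Proof. by rewrite /sqnorm dotDl !dotDr (dotC v u); ring. Qed.

Lemma sqnormB u v : sqnorm (u - v) = sqnorm u - 2 * dot u v + sqnorm v.
Proof. by rewrite sqnormD dotNr sqnormN mulrN. Qed.

Lemma dot_mulmx u v : (u^T *m v) 0 0 = dot u v.
Proof. by rewrite mxE; apply: eq_bigr => i _; rewrite mxE. Qed.

End Dot.

Section HexagonVectors.
Variables (R : realType) (X Y : finType) (inc : X -> Y -> bool).
Hypothesis hexH : generalized_hexagon inc.
Hypothesis orderH : has_order inc 2 8.

Notation g := (kernel R hexH).
Notation v := (hexagon_vector R inc).
Notation L := (hexagon_lattice R inc).

Lemma idem26E i j : idem26 R inc i j = g (enum_val i) (enum_val j) / 84.
Proof.
rewrite /idem26 /dist_mx !mxE !graph_dist_collinearE // kernel_dist.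
have -> : (i == j) = (point_dist hexH (enum_val i) (enum_val j) == 0%N).
  by rewrite point_dist_eq0 (inj_eq enum_val_inj).
have := point_dist_le3 hexH (enum_val i) (enum_val j).
by case: point_dist => [|[|[|[|//]]]] _ /=; field.
Qed.

Let sqrt84_neq0 : Num.sqrt 84 != 0 :> R.
Proof. by rewrite sqrtr_eq0 -ltNge ltr0n. Qed.

Let sqr_sqrt84 : Num.sqrt 84 ^+ 2 = 84 :> R.
Proof. by rewrite sqr_sqrtr ?ler0n. Qed.

Lemma hexagon_vectorE x i : v x i 0 = g x (enum_val i) / Num.sqrt 84.
Proof.
rewrite /hexagon_vector mxE mxE (bigD1 (enum_rank x)) //= big1 => [|j jx]; last first.
  by rewrite [delta_mx _ _ _ _]mxE (negbTE jx) mulr0.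
rewrite addr0 [delta_mx _ _ _ _]mxE !eqxx mulr1 idem26E enum_rankK kernel_sym.
by apply: (canRL (mulfK sqrt84_neq0)); rewrite mulrAC -expr2 sqr_sqrt84; field.
Qed.

Lemma dot_hexagon_vector x y : dot (v x) (v y) = g x y.
Proof.
rewrite /dot; under eq_bigr do rewrite !hexagon_vectorE.
transitivity (\sum_z g x z / Num.sqrt 84 * (g y z / Num.sqrt 84)).
  rewrite [RHS](reindex (@enum_val X predT)) //=.
  by exists enum_rank => z _; [exact: enum_valK|exact: enum_rankK].
transitivity ((\sum_z g x z * g y z) / 84).
  rewrite mulr_suml; apply: eq_bigr => z _.
  by move: sqrt84_neq0 sqr_sqrt84; set s := Num.sqrt _ => s84 <-; field.
rewrite kernel_reproducing; [|exact: orderH|exact: kernel_line_sum].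
by rewrite kernel_sym; field.
Qed.

Lemma sqnorm_hexagon_vector x : sqnorm (v x) = 8 / 3.
Proof. by rewrite /sqnorm dot_hexagon_vector kernel_diag. Qed.

Definition coef (u : 'cV[R]_#|X|) (x : X) : R := dot u (v x).

Definition hspan (u : 'cV[R]_#|X|) : Prop :=
  exists a : X -> R, u = \sum_x a x *: v x.

Lemma hspan_vector x : hspan (v x).
Proof.
exists (fun y => (y == x)%:R); rewrite (bigD1 x) //= eqxx scale1r big1 ?addr0 // => y yx.
by rewrite (negbTE yx) scale0r.
Qed.

Lemma hspan0 : hspan 0.
Proof. by exists (fun=> 0); rewrite big1 // => y _; rewrite scale0r. Qed.

Lemma hspanD u w : hspan u -> hspan w -> hspan (u + w).
Proof.
move=> [a ->] [b ->]; exists (fun x => a x + b x).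
by rewrite -big_split; apply: eq_bigr => x _; rewrite scalerDl.
Qed.

Lemma hspanZ k u : hspan u -> hspan (k *: u).
Proof.
move=> [a ->]; exists (fun x => k * a x).
by rewrite scaler_sumr; apply: eq_bigr => x _; rewrite scalerA.
Qed.

Lemma hspanN u : hspan u -> hspan (- u).
Proof. by move=> su; rewrite -scaleN1r; exact: hspanZ. Qed.

Lemma coef_vector x y : coef (v x) y = g x y.
Proof. exact: dot_hexagon_vector. Qed.

Lemma coefD u w x : coef (u + w) x = coef u x + coef w x.
Proof. exact: dotDl. Qed.

Lemma coefN u x : coef (- u) x = - coef u x.
Proof. exact: dotNl. Qed.

Lemma coefZ k u x : coef (k *: u) x = k * coef u x.
Proof. exact: dotZl. Qed.

Lemma coef_sum (a : X -> R) y : coef (\sum_x a x *: v x) y = \sum_x a x * g x y.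
Proof. by rewrite /coef dot_suml; apply: eq_bigr => x _; rewrite dotZl dot_hexagon_vector. Qed.

Lemma coef_line_sum u : hspan u -> line_sum0 inc (coef u).
Proof.
move=> [a ->] l; under eq_bigr do rewrite coef_sum.
rewrite exchange_big big1 //= => x _.
by rewrite -mulr_sumr kernel_line_sum ?mulr0.
Qed.

Lemma coef_reproducing u : hspan u -> reproducing g (coef u).
Proof. by move=> su z; apply: kernel_reproducing => //; exact: coef_line_sum. Qed.

(** The [v x] form a tight frame. The coordinates of [v x] are kernel values divided by
    [Num.sqrt 84], so this is the reproducing property read coordinate by coordinate. *)
Lemma sum_coef_vector u : hspan u -> \sum_x coef u x *: v x = 84 *: u.
Proof.
move=> [a ->]; rewrite scaler_sumr.
under eq_bigr do rewrite coef_sum scaler_suml.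
rewrite exchange_big /=; apply: eq_bigr => x _.
rewrite scalerA [84 * _]mulrC -scalerA; under eq_bigr do rewrite -scalerA.
rewrite -scaler_sumr; congr (_ *: _); apply/matrixP => i j; rewrite ord1.
rewrite summxE mxE hexagon_vectorE mulrA.
rewrite (_ : 84 * g x (enum_val i) = \sum_y g (enum_val i) y * g x y).
  rewrite mulr_suml; apply: eq_bigr => y _.
  by rewrite mxE hexagon_vectorE [g (enum_val i) y]kernel_sym; ring.
by rewrite (@kernel_reproducing R X Y inc hexH orderH) //; exact: kernel_line_sum.
Qed.

Lemma dot_coef u w : hspan u -> dot u w = ip (coef u) (coef w).
Proof.
move=> su; apply: (@mulfI _ 84); first by rewrite pnatr_eq0.
rewrite -dotZl -sum_coef_vector // dot_suml.
transitivity (\sum_x coef u x * coef w x); last by rewrite /ip; field.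
by apply: eq_bigr => x _; rewrite dotZl /coef (dotC w).
Qed.

Lemma coef_eq0 u : hspan u -> (forall x, coef u x = 0) -> u = 0.
Proof.
move=> su u0; apply: sqnorm_eq0; rewrite /sqnorm dot_coef // /ip.
by rewrite big1 ?mul0r // => x _; rewrite u0 mul0r.
Qed.

Lemma coef_moment2 u : hspan u -> \sum_x coef u x ^+ 2 = 84 * sqnorm u.
Proof.
by move=> su; rewrite /sqnorm dot_coef // /ip mulrCA divff ?mulr1 ?pnatr_eq0.
Qed.

Lemma coef_quartic a b c d : hspan a -> hspan b -> hspan c -> hspan d ->
  \sum_x coef a x * coef b x * coef c x * coef d x =
  8 * (dot a b * dot c d + dot a c * dot b d + dot a d * dot b c).
Proof.
move=> sa sb sc sd; rewrite (@quartic_identity _ _ g) ?dot_coef //.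
- exact: kernel_sym.
- exact: kernel_diag.
- by move=> z y; apply: kernel_reproducing => //; exact: kernel_line_sum.
- exact: card_points orderH.
- by move=> z; rewrite (sum_kernel_pow R hexH orderH); field.
all: exact: coef_reproducing.
Qed.

Lemma coef_moment4 u : hspan u -> \sum_x coef u x ^+ 4 = 24 * sqnorm u ^+ 2.
Proof.
move=> su; have := coef_quartic su su su su; rewrite -/(sqnorm u).
by under eq_bigr do rewrite -!expr2 -!exprSr; move=> ->; ring.
Qed.

Lemma coef_moment31 u z : hspan u ->
  \sum_x coef u x ^+ 3 * g z x = 24 * sqnorm u * coef u z.
Proof.
move=> su; have := coef_quartic su su su (hspan_vector z).
rewrite -/(sqnorm u) -/(coef u z) => E.
transitivity (8 * (sqnorm u * coef u z + sqnorm u * coef u z + coef u z * sqnorm u));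
  last by ring.
by rewrite -E; apply: eq_bigr => x _; rewrite coef_vector; ring.
Qed.

Lemma coef_moment22 u z : hspan u ->
  \sum_x coef u x ^+ 2 * g z x ^+ 2 = 8 * (8 / 3 * sqnorm u + 2 * coef u z ^+ 2).
Proof.
move=> su; have := coef_quartic su su (hspan_vector z) (hspan_vector z).
rewrite -/(sqnorm u) -/(coef u z) dot_hexagon_vector kernel_diag => E.
transitivity (8 * (sqnorm u * (8 / 3) + coef u z * coef u z + coef u z * coef u z)); last by ring.
by rewrite -E; apply: eq_bigr => x _; rewrite coef_vector; ring.
Qed.

End HexagonVectors.

Lemma even_sum_symmetric (I : finType) (f : I -> I -> int) :
  (forall i j, f i j = f j i) -> (forall i, (2 %| f i i)%Z) ->
  (2 %| \sum_i \sum_j f i j)%Z.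
Proof.
move=> f_sym f_even.
pose lt (i j : I) := (enum_rank i < enum_rank j)%N.
have -> : \sum_i \sum_j f i j =
    \sum_i f i i + 2 * \sum_i \sum_(j | lt i j) f i j.
  have swap : \sum_i \sum_(j | lt i j) f i j = \sum_i \sum_(j | lt j i) f j i.
    by rewrite (exchange_big_dep predT).
  rewrite mulr2n mulrDl !mul1r {2}swap -!big_split /=.
  apply: eq_bigr => i _; rewrite (bigD1 i) //=; congr (_ + _).
  rewrite (bigID (lt i)) /=; congr (_ + _).
    by apply: eq_bigl => j; rewrite /lt; case: eqP => // ->; rewrite ltnn.
  rewrite [RHS](eq_bigr (f i)) => [|j _]; last exact: f_sym.
  apply: eq_bigl => j; rewrite /lt -leqNgt ltn_neqAle; congr (_ && _).
  by rewrite (inj_eq val_inj) (inj_eq enum_rank_inj).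
rewrite rpredD ?dvdz_mulr //.
by apply: rpred_sum => i _; exact: f_even.
Qed.

(** * Integrality and evenness *)

Section HexagonLatticeIntegral.
Variables (R : realType) (X Y : finType) (inc : X -> Y -> bool).
Hypothesis hexH : generalized_hexagon inc.
Hypothesis orderH : has_order inc 2 8.

Notation g := (kernel R hexH).
Notation v := (hexagon_vector R inc).
Notation L := (hexagon_lattice R inc).
Notation coef := (@coef R X Y inc).
Notation hspan := (@hspan R X Y inc).

Lemma lattice_hspan u : L u -> hspan u.
Proof.
by move=> [a [_ ->]]; exists (fun x => (a x)%:~R); apply: eq_bigr => x _; rewrite scaler_int.
Qed.

Lemma lattice0 : L 0.
Proof. by exists (fun=> 0); rewrite !big1 // => x _; rewrite mulr0z. Qed.

Lemma latticeD u w : L u -> L w -> L (u + w).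
Proof.
move=> [a [a3 ->]] [b [b3 ->]]; exists (fun x => a x + b x); split.
  by rewrite big_split rpredD.
by rewrite -big_split; apply: eq_bigr => x _; rewrite mulrzDr.
Qed.

Lemma latticeMz u k : L u -> L (u *~ k).
Proof.
move=> [a [a3 ->]]; exists (fun x => a x * k); split.
  by rewrite -mulr_suml dvdz_mulr.
rewrite -scaler_int scaler_sumr; apply: eq_bigr => x _.
by rewrite scaler_int mulrzA.
Qed.

Lemma latticeN u : L u -> L (- u).
Proof. by move=> Lu; rewrite -[u]mulr1z -mulrNz; exact: latticeMz. Qed.

Lemma sum_indicator_vector x (k : int) : \sum_y v y *~ ((y == x)%:R * k) = v x *~ k.
Proof.
rewrite (bigD1 x) //= eqxx mul1r big1 ?addr0 // => y yx.
by rewrite (negbTE yx) mul0r mulr0z.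
Qed.

Lemma sum_indicator x (k : int) : \sum_(y : X) (y == x)%:R * k = k.
Proof.
rewrite (bigD1 x) //= eqxx mul1r big1 ?addr0 // => y yx.
by rewrite (negbTE yx) mul0r.
Qed.

Lemma lattice_vectorB x y : L (v x - v y).
Proof.
exists (fun z => (z == x)%:R * 1 + (z == y)%:R * - 1).
rewrite big_split /= !sum_indicator; split=> //.
under [RHS]eq_bigr do rewrite mulrzDr.
by rewrite big_split /= !sum_indicator_vector mulr1z mulrNz mulr1z.
Qed.

Lemma lattice_vector3 x : L (v x *~ 3).
Proof.
by exists (fun z => (z == x)%:R * 3); rewrite sum_indicator sum_indicator_vector.
Qed.

(** All inner products of generators agree modulo 1, so a coefficient sum divisible by 3 makes the
    products with every generator integral. *)
Lemma kernel_mod1 x y : g x y - 2 / 3 \is a Num.int.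
Proof.
rewrite kernel_dist; apply/intrP; have := point_dist_le3 hexH x y.
case: point_dist => [|[|[|[|//]]]] _ /=.
- by exists 2; field.
- by exists (- 2); field.
- by exists 0; field.
- by exists (- 1); field.
Qed.

(* The dual of the lattice generated by all the vectors [v x]. *)
Definition integral_dual u := hspan u /\ forall x, coef u x \is a Num.int.

Lemma lattice_integral_dual u : L u -> integral_dual u.
Proof.
move=> Lu; split; first exact: lattice_hspan.
move: Lu => [a [/dvdzP[q aq] ->]] y.
have -> : coef (\sum_x v x *~ a x) y = 2 * q%:~R + \sum_x (a x)%:~R * (g x y - 2 / 3).
  transitivity (\sum_x (a x)%:~R * g x y).
    by rewrite -(coef_sum hexH orderH); congr coef; apply: eq_bigr => x _; rewrite scaler_int.
  rewrite [RHS](_ : _ = 2 * q%:~R + (\sum_x (a x)%:~R * g x y - 2 / 3 * (\sum_x a x)%:~R)); last first.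
    congr (_ + _); rewrite rmorph_sum mulr_sumr -sumrB.
    by apply: eq_bigr => x _; rewrite mulrBr [2 / 3 * _]mulrC.
  by rewrite aq intrM; field.
rewrite rpredD ?rpredM ?rpred_int //=.
by apply: rpred_sum => x _; rewrite rpredM ?intr_int ?kernel_mod1.
Qed.

Lemma integral_dual_dot u w : integral_dual u -> L w -> dot u w \is a Num.int.
Proof.
move=> [su ui] [a [_ ->]]; rewrite dot_sumr rpred_sum // => x _.
by rewrite -scaler_int dotZr rpredM ?intr_int // ui.
Qed.

Lemma lattice_integral : is_integral L.
Proof.
by move=> u w /lattice_integral_dual du Lw; apply/intrP; exact: integral_dual_dot.
Qed.

(** Three times the Gram matrix of the generators is integral and symmetric with diagonal 8, so
    [3 * sqnorm u] is even; and 3 is odd. *)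
Lemma lattice_even : is_even L.
Proof.
move=> u Lu; have [k uk] := lattice_integral Lu Lu; rewrite -/(sqnorm u) in uk.
have [a [_ ua]] := Lu.
pose M x y : int := nth 0 [:: 8; - 4; 2; - 1] (point_dist hexH x y).
have gM x y : 3 * g x y = (M x y)%:~R.
  rewrite kernel_dist /M; have := point_dist_le3 hexH x y.
  by case: point_dist => [|[|[|[|//]]]] _ /=; field.
have E : (3 * k = \sum_x \sum_y a x * a y * M x y).
  apply: (@intr_inj R); rewrite intrM -uk ua /sqnorm dot_suml mulr_sumr rmorph_sum.
  apply: eq_bigr => x _; rewrite dot_sumr mulr_sumr rmorph_sum; apply: eq_bigr => y _.
  rewrite -!scaler_int dotZl dotZr (dot_hexagon_vector R hexH orderH) /= !intrM -gM; ring.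
have : (2 %| 3 * k)%Z.
  rewrite E; apply: even_sum_symmetric => [x y|x].
    by rewrite /M point_dist_sym; ring.
  have /eqP dxx : point_dist hexH x x == 0%N by rewrite point_dist_eq0.
  have -> : M x x = 8 by rewrite /M dxx.
  by rewrite dvdz_mull.
rewrite Gauss_dvdzr // => /dvdzP[q kq]; exists q; by rewrite uk kq mulrC.
Qed.

End HexagonLatticeIntegral.

(* The discriminant [81 * 601] is not a square: the real roots lie strictly
   between 56 and 57 and between 276 and 277. *)
Lemma no_integer_root (s : int) : s ^+ 2 - 333 * s + 15552 <> 0.
Proof.
have [le56|[/andP[ge57 le276]|ge277]] : s <= 56 \/ 57 <= s <= 276 \/ 277 <= s by lia.
- have := @mulr_ge0 _ (56 - s) (277 - s); rewrite !subr_ge0 expr2; lia.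
- have := @mulr_ge0 _ (s - 57) (276 - s); rewrite !subr_ge0 expr2; lia.
- have := @mulr_ge0 _ (s - 56) (s - 277); rewrite !subr_ge0 expr2; lia.
Qed.

(** * The three points of a line *)

Section Lines.
Variables (R : realType) (X Y : finType) (inc : X -> Y -> bool).
Hypothesis hexH : generalized_hexagon inc.
Hypothesis orderH : has_order inc 2 8.

Lemma line_points x l : inc x l -> exists y y',
  [/\ [/\ inc y l, inc y' l, x != y, x != y' & y != y'],
      forall z, inc z l -> [|| z == x, z == y | z == y']
    & forall (V : nmodType) (c : X -> V), \sum_(z | inc z l) c z = c x + c y + c y'].
Proof.
move=> xl; have c3 := orderH.1 l.
rewrite (cardD1 x) inE xl add1n in c3; case: c3 => c2.
have [|y] := @card_gt0P _ [predD1 [pred x | inc x l] & x] _; first by rewrite c2.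
rewrite !inE => /andP[yx yl].
rewrite (cardD1 y) !inE yx yl add1n in c2; case: c2 => c1.
have [|y'] := @card_gt0P _ [predD1 [predD1 [pred x | inc x l] & x] & y] _.
  by rewrite c1.
rewrite !inE => /and3P[y'y y'x y'l].
rewrite (cardD1 y') !inE y'x y'y y'l add1n in c1; case: c1 => /card0_eq c0.
have all3 z : inc z l -> [|| z == x, z == y | z == y'].
  move=> zl; have := c0 z; rewrite !inE zl andbT.
  by case: (z == x); case: (z == y); case: (z == y').
exists y, y'; split=> //.
  by rewrite yl y'l ![x == _]eq_sym yx y'x [y == _]eq_sym y'y.
move=> V c; rewrite (bigD1 x) //= (bigD1 y) ?yl //= (bigD1 y') ?y'l ?y'x //= big1 ?addr0 ?addrA //.
move=> z /andP[/andP[/andP[/all3]]].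
by case: (z == x); case: (z == y); case: (z == y').
Qed.

Lemma incident_dist1 x y l : inc x l -> inc y l -> x != y -> point_dist hexH x y = 1%N.
Proof.
by move=> xl yl xy; apply/collinearP; rewrite /collinear xy; apply/existsP; exists l; rewrite xl.
Qed.

Lemma third_point x y : point_dist hexH x y = 1%N -> exists y',
  [/\ point_dist hexH x y' = 1%N, point_dist hexH y y' = 1%N
    & forall c : X -> R, line_sum0 inc c -> c x + c y + c y' = 0].
Proof.
move=> /collinearP /andP[xy /existsP[l /andP[xl yl]]].
have [a [b [[al bl xa xb ab] all3 sum3]]] := line_points xl.
have := all3 y yl; rewrite eq_sym (negbTE xy) /= => /orP[]/eqP->.
  exists b; split; [exact: incident_dist1 xl bl xb|exact: incident_dist1 al bl ab|].
  by move=> c /(_ l); rewrite sum3.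
exists a; split; [exact: incident_dist1 xl al xa|by apply: incident_dist1 bl al _; rewrite eq_sym|].
by move=> c /(_ l); rewrite sum3 addrAC.
Qed.

Lemma exists_neighbour x : exists y, point_dist hexH x y = 1%N.
Proof.
have /card_gt0P[l xl] : (0 < #|[pred l | inc x l]|)%N by rewrite orderH.2.
have [a [b [[al bl xa xb ab] _ _]]] := line_points xl.
by exists a; exact: incident_dist1 xl al xa.
Qed.

End Lines.

(** * Reduction modulo the lattice *)

Section Reduction.
Variables (R : realType) (X Y : finType) (inc : X -> Y -> bool).
Hypothesis hexH : generalized_hexagon inc.
Hypothesis orderH : has_order inc 2 8.

Notation g := (kernel R hexH).
Notation v := (hexagon_vector R inc).
Notation L := (hexagon_lattice R inc).
Notation coef := (@coef R X Y inc).
Notation hspan := (@hspan R X Y inc).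
Notation integral_dual := (@integral_dual R X Y inc).

Lemma integral_dualD u w : integral_dual u -> integral_dual w -> integral_dual (u + w).
Proof.
move=> [su ui] [sw wi]; split; first exact: hspanD.
by move=> x; rewrite coefD rpredD.
Qed.

Lemma integral_dualN u : integral_dual u -> integral_dual (- u).
Proof.
move=> [su ui]; split; first exact: hspanN.
by move=> x; rewrite coefN rpredN.
Qed.

Lemma integral_dualB u w : integral_dual u -> integral_dual w -> integral_dual (u - w).
Proof. by move=> du dw; apply: integral_dualD => //; exact: integral_dualN. Qed.

Lemma sum_coef4_coef2 u : hspan u ->
  \sum_x (coef u x ^+ 4 - coef u x ^+ 2) / 12 = 2 * sqnorm u ^+ 2 - 7 * sqnorm u.
Proof.
move=> su; rewrite -mulr_suml sumrB (coef_moment4 hexH orderH) // (coef_moment2 hexH orderH) //.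
by field.
Qed.

Lemma integral_dual_gap u : integral_dual u -> 0 <= 2 * sqnorm u ^+ 2 - 7 * sqnorm u.
Proof.
move=> [su ui]; rewrite -sum_coef4_coef2 //; apply: sumr_ge0 => x _.
have /intrP[m ->] := ui x; rewrite divr_ge0 // -!rmorphXn -rmorphB ler0z.
by have := sqr_ge0 (m ^+ 2); rewrite !exprSr expr0; nia.
Qed.

(** Expanding [sqnorm (u - w)] shows that the second condition makes [u] a shortest vector of its
    class modulo the lattice. *)
Definition reduced u :=
  integral_dual u /\ forall w, L w -> 2 * dot u w <= sqnorm w.

Lemma reducedN u : reduced u -> reduced (- u).
Proof.
move=> [du min]; split; first exact: integral_dualN.
move=> w Lw; have := min (- w) (latticeN Lw).
by rewrite dotNr dotNl sqnormN.
Qed.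

(** Subtracting a violating lattice vector shortens [u]. The descent stops because [84 * sqnorm u]
    is a sum of squares of integers. *)
Lemma exists_reduced u : integral_dual u -> exists2 w, L w & reduced (u - w).
Proof.
move=> du.
have norm_nat w : integral_dual w -> exists n : nat, 84 * sqnorm w = n%:R.
  move=> [sw wi]; apply/natrP; rewrite natrEint mulr_ge0 ?sqnorm_ge0 // andbT.
  rewrite -(coef_moment2 hexH orderH) //; apply: rpred_sum => x _.
  by rewrite rpredX.
have [n un] := norm_nat u du; elim/ltn_ind: n u du un => n IH u du un.
have [min|] := pselect (forall w, L w -> 2 * dot u w <= sqnorm w).
  by exists 0; [exact: lattice0|rewrite subr0].
move=> /existsNP[w /not_implyP[Lw /negP]]; rewrite -ltNge => lt_w.
have dw := lattice_integral_dual hexH orderH Lw.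
have duw := integral_dualB du dw; have [m uwm] := norm_nat _ duw.
have mn : (m < n)%N by rewrite -(ltr_nat R) -un -uwm sqnormB; lra.
have [w' Lw' red] := IH m mn _ duw uwm.
by exists (w + w'); [exact: latticeD|rewrite opprD addrA].
Qed.

Section ReducedVector.
Variable u : 'cV[R]_#|X|.
Hypothesis red : reduced u.

Notation c := (coef u).

(** The lattice vector [v x - v y] has norm 0, 8, 4 or 6 at distance 0, 1, 2, 3; the bounds are half
    of these. *)
Lemma reduced_coefB x y : c x - c y <=
  nth 0 [:: 0; 4; 2; 3] (point_dist hexH x y).
Proof.
have := red.2 _ (lattice_vectorB R inc x y); rewrite dotBr -!/(coef u _) sqnormB /sqnorm.
rewrite !(dot_hexagon_vector R hexH orderH) !kernel_diag kernel_dist.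
have := point_dist_le3 hexH x y.
by case: point_dist => [|[|[|[|//]]]] _ /=; lra.
Qed.

Lemma reduced_coef_int x : exists m : int, c x = m%:~R.
Proof. by apply/intrP; exact: red.1.2. Qed.

(** On a line through [x] the entries sum to zero, so adding the bounds for its two other points
    gives [3 * c x <= 8]. *)
Lemma reduced_coef_le2 x : c x <= 2.
Proof.
have [m cm] := reduced_coef_int x.
have [y dy] := exists_neighbour hexH orderH x.
have [y' [dy' _ /(_ _ (coef_line_sum hexH orderH red.1.1)) s0]] := third_point R orderH dy.
have := reduced_coefB x y; have := reduced_coefB x y'; rewrite dy dy' /= => le1 le2.
have : c x < 3%:~R by lra.
by rewrite cm ltr_int => m3; rewrite (ler_int R m 2); lia.
Qed.

End ReducedVector.

Lemma reduced_coef_values u x : reduced u ->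
  coef u x = - 2 \/ [\/ coef u x = - 1, coef u x = 0, coef u x = 1 | coef u x = 2].
Proof.
move=> red; have [m cm] := reduced_coef_int red x.
have := reduced_coef_le2 red x; have := reduced_coef_le2 (reducedN red) x.
rewrite coefN cm -rmorphN (ler_int R _ 2) (ler_int R _ 2) => le1 le2.
have : m = - 2 \/ [\/ m = - 1, m = 0, m = 1 | m = 2].
  have [|[|[|[|]]]] : m = - 2 \/ m = - 1 \/ m = 0 \/ m = 1 \/ m = 2 by lia.
  - by left.
  - by right; constructor 1.
  - by right; constructor 2.
  - by right; constructor 3.
  - by right; constructor 4.
by case=> [->|[] ->]; [left|right; constructor 1|right; constructor 2|
  right; constructor 3|right; constructor 4].
Qed.

(* The sign of the entries of absolute value 2; for the other entries
   of a reduced vector [c ^+ 3 = c]. *)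
Definition two_sign u x : R := (coef u x ^+ 3 - coef u x) / 6.

Lemma two_sign_values u x : reduced u ->
  [/\ coef u x = 2 -> two_sign u x = 1, coef u x = - 2 -> two_sign u x = - 1
    & coef u x <> 2 -> coef u x <> - 2 -> two_sign u x = 0].
Proof.
move=> red; rewrite /two_sign; split=> [->|->|]; [by field|by field|].
by have [->|[] ->] := reduced_coef_values x red => // _ _; field.
Qed.

Notation shell := (shell hexH).

Lemma shellD z i (a b : X -> R) : shell z i (fun x => a x + b x) = shell z i a + shell z i b.
Proof. exact: big_split. Qed.

Lemma shellZ z i k (a : X -> R) : shell z i (fun x => k * a x) = k * shell z i a.
Proof. by rewrite /shell mulr_sumr. Qed.

Lemma eq_shell z i (a b : X -> R) :
  (forall x, point_dist hexH z x = i -> a x = b x) -> shell z i a = shell z i b.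
Proof. by move=> ab; apply: eq_bigr => x /eqP; exact: ab. Qed.

Lemma shell_ge0 z i (a : X -> R) :
  (forall x, point_dist hexH z x = i -> 0 <= a x) -> 0 <= shell z i a.
Proof. by move=> a0; apply: sumr_ge0 => x /eqP; exact: a0. Qed.

Lemma sum_kernel_shells z (f : X -> R) n : \sum_x f x * g z x ^+ n =
  (8 / 3) ^+ n * f z + (- (4 / 3)) ^+ n * shell z 1 f + (2 / 3) ^+ n * shell z 2 f
  + (- (1 / 3)) ^+ n * shell z 3 f.
Proof.
rewrite (sum_shells hexH z) kernel_diag; congr (_ + _ + _ + _); first by rewrite mulrC.
all: by rewrite -shellZ; apply: eq_shell => x dx; rewrite kernel_dist dx mulrC.
Qed.

(* [B], [Q], [S] count the entries [-2] at distance 1 and the entries [2] at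
   distances 2 and 3 from [z]; there are no others. *)
Lemma reduced_two_local u z : reduced u -> coef u z = 2 ->
  exists B Q S : R,
  [/\ [/\ 0 <= B, 0 <= Q & 0 <= S], Q \is a Num.int,
     36 * sqnorm u = 126 + 10 * B + 2 * Q /\ 24 * sqnorm u = 92 + 4 * B + 2 * Q - S,
     \sum_x two_sign u x ^+ 2 = 1 + B + Q + S
   & \sum_x two_sign u x = 1 - B + Q + S].
Proof.
move=> red cz; have [[su ui] _] := red.
have val x := reduced_coef_values x red.
have zero := coef_line_sum hexH orderH su.
(* The other two entries on a line through [z] sum to [- 2], and neither is below [- 2]. *)
have near x : point_dist hexH z x = 1%N ->
    [\/ coef u x = - 2, coef u x = - 1 | coef u x = 0].
  move=> dx; have [y [_ _ /(_ _ zero)]] := third_point R orderH dx.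
  by have [->|[] ->] := val x; have [->|[] ->] := val y; rewrite cz => E;
     solve [by constructor 1|by constructor 2|by constructor 3|lra].
have mid x : point_dist hexH z x = 2%N ->
    [\/ coef u x = 0, coef u x = 1 | coef u x = 2].
  move=> dx; have := reduced_coefB red z x; rewrite dx cz /=.
  by have [->|[] ->] := val x => E;
     solve [by constructor 1|by constructor 2|by constructor 3|lra].
have far x : point_dist hexH z x = 3%N ->
    [\/ coef u x = - 1, coef u x = 0, coef u x = 1 | coef u x = 2].
  move=> dx; have := reduced_coefB red z x; rewrite dx cz /=.
  by have [->|[] ->] := val x => E;
     solve [by constructor 1|by constructor 2|by constructor 3|by constructor 4|lra].
pose e := two_sign u; pose c2 x := coef u x ^+ 2.
have ez : e z = 1 by rewrite /e /two_sign cz; field.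
have [C1 C2 C3] := shell_line_sum0 hexH orderH z zero; rewrite cz in C1 C2 C3.
(* On the values [-2, -1, 0] a square is [- c - 2 e], on [0, 1, 2] it is [c + 2 e]; the shell sums
   of squares thus depend on the counts only. *)
have near2 : shell z 1 c2 = 18 - 2 * shell z 1 e.
  transitivity (- 1 * shell z 1 (coef u) + - 2 * shell z 1 e); last by rewrite C1; ring.
  rewrite -!shellZ -shellD; apply: eq_shell => x /near.
  by rewrite /c2 /e /two_sign => -[] ->; field.
have mid2 : shell z 2 c2 = 144 + 2 * shell z 2 e.
  transitivity (shell z 2 (coef u) + 2 * shell z 2 e); last by rewrite C2; ring.
  rewrite -!shellZ -shellD; apply: eq_shell => x /mid.
  by rewrite /c2 /e /two_sign => -[] ->; field.
(* Eliminating the sum of squares over the third shell from [M2] and [M22] gives the first relation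
   for the norm. The second is [Me], which combines [M31] with the reproducing property. *)
have M2 := coef_moment2 hexH orderH su.
rewrite (sum_shells hexH z) cz in M2.
have M22 := coef_moment22 hexH orderH z su.
rewrite (sum_kernel_shells z c2) cz /c2 cz -!/(c2) in M22.
have M31 := coef_moment31 hexH orderH z su.
have Mg := coef_reproducing hexH orderH su z.
have Me : \sum_x e x * g z x ^+ 1 = 8 * sqnorm u - 28.
  transitivity ((24 * sqnorm u * coef u z - 84 * coef u z) / 6); last by rewrite cz; field.
  rewrite -M31 -Mg -sumrB mulr_suml; apply: eq_bigr => x _.
  by rewrite /e /two_sign; field.
rewrite (sum_kernel_shells z e) ez in Me.
exists (- shell z 1 e), (shell z 2 e), (shell z 3 e); split.
- split; first rewrite -mulN1r -shellZ; apply: shell_ge0 => x.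
  + by move=> /near; rewrite /e /two_sign => -[] ->; lra.
  + by move=> /mid; rewrite /e /two_sign => -[] ->; lra.
  + by move=> /far; rewrite /e /two_sign => -[] ->; lra.
- apply: rpred_sum => x /eqP /mid; rewrite /e /two_sign => -[] ->; apply/intrP.
  + by exists 0; field.
  + by exists 0; field.
  + by exists 1; field.
- by split; lra.
- rewrite (sum_shells hexH z (fun x => e x ^+ 2)) ez expr1n; congr (_ + _ + _ + _).
  + rewrite -mulN1r -shellZ; apply: eq_shell => x /near.
    by rewrite /e /two_sign => -[] ->; field.
  + by apply: eq_shell => x /mid; rewrite /e /two_sign => -[] ->; field.
  + by apply: eq_shell => x /far; rewrite /e /two_sign => -[] ->; field.
- by rewrite (sum_shells hexH z) opprK -[two_sign u z]/(e z) ez.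
Qed.

(** On integers of absolute value at most 2, [(c^4 - c^2) / 12] is the indicator of absolute value
    2. So the norm fixes the number of such entries. *)
Lemma sum_two_sign_sq u : reduced u ->
  \sum_x two_sign u x ^+ 2 = 2 * sqnorm u ^+ 2 - 7 * sqnorm u.
Proof.
move=> red; rewrite -sum_coef4_coef2; last exact: red.1.1.
apply: eq_bigr => x _; rewrite /two_sign.
by have [->|[] ->] := reduced_coef_values x red; field.
Qed.

Lemma two_signN u x : two_sign (- u) x = - two_sign u x.
Proof. by rewrite /two_sign coefN; field. Qed.

Lemma reduced_coef_neq2 u z : reduced u -> coef u z <> 2.
Proof.
move=> red cz; have [B [Q [S [[B0 Q0 S0] Qint [E1 E2] E3 E4]]]] := reduced_two_local red cz.
have sq := sum_two_sign_sq red; set N := sqnorm u in E1 E2 sq.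
have [[y cy]|noneg] := pselect (exists y, coef u y = - 2).
  have cy' : coef (- u) y = 2 by rewrite coefN cy opprK.
  have [B' [Q' [S' [[B'0 Q'0 S'0] _ [E1' E2'] E3' E4']]]] := reduced_two_local (reducedN red) cy'.
  have := sum_two_sign_sq (reducedN red); rewrite E3' sqnormN -/N => sq'.
  rewrite sqnormN -/N in E1' E2'.
  have : \sum_x two_sign (- u) x = - \sum_x two_sign u x.
    by rewrite -sumrN; apply: eq_bigr => x _; rewrite two_signN.
  rewrite E4' E4 => E5.
  have BB : B = B' by lra.
  (* The counts now give [B = Q + S + 1 = (5 N - 16) / 2], so there are [5 N - 16 = 2 N^2 - 7 N]
     entries of absolute value 2. The root 2 makes [B] negative, the root 4 makes [Q] negative. *)
  have N2 : (N - 2) * (N - 4) = 0 by lra.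
  move/eqP: N2; rewrite mulf_eq0 => /orP[] /eqP N2; lra.
have e0 x : 0 <= two_sign u x.
  have [v2 vN2 v0] := two_sign_values x red.
  have [c2|c2] := eqVneq (coef u x) 2; first by rewrite v2.
  by rewrite v0 //; [exact/eqP|move=> cN2; apply: noneg; exists x].
have B1 : B = 0.
  have : \sum_x (two_sign u x ^+ 2 - two_sign u x) = 0.
    apply: big1 => x _; have [v2 vN2 v0] := two_sign_values x red.
    have [c2|c2] := eqVneq (coef u x) 2; first by rewrite v2 // expr1n subrr.
    have cN2 : coef u x <> - 2 by move=> cN2; apply: noneg; exists x.
    by rewrite v0 //; [rewrite expr0n subrr|exact/eqP].
  rewrite sumrB E3 E4; lra.
have /intrP[q Qq] := Qint.
(* With [B = 0] the counts leave [2 N^2 - 37 N + 96 = 0]; in terms of the integer [18 N = 63 + q]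
   this is the equation of [no_integer_root]. *)
have NE : N = (63 + q%:~R) / 18 by rewrite -Qq; lra.
have qE : (63 + q) ^+ 2 - 333 * (63 + q) + 15552 = 0.
  apply: (@intr_inj R); transitivity (162 * (2 * N ^+ 2 - 37 * N + 96)).
    by rewrite NE; field.
  by rewrite (_ : _ + 96 = 0) ?mulr0 //; lra.
exact: (no_integer_root qE).
Qed.

Lemma reduced_norm u : reduced u -> u = 0 \/ sqnorm u = 7 / 2.
Proof.
move=> red; have := sum_two_sign_sq red.
rewrite big1 => [/esym|x _].
  have -> : 2 * sqnorm u ^+ 2 - 7 * sqnorm u = sqnorm u * (2 * sqnorm u - 7) by ring.
  move=> /eqP; rewrite mulf_eq0 => /orP[/eqP/sqnorm_eq0|/eqP E]; [by left|right; lra].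
have [_ _ ->] := two_sign_values x red; first by rewrite expr0n.
- exact: reduced_coef_neq2.
move=> c2; apply: (reduced_coef_neq2 (reducedN red) (z := x)).
by rewrite coefN c2 opprK.
Qed.

End Reduction.

(** * Integer matrices and Gram determinants *)

Section IntegerMatrices.

(* Modulo 2 the matrix agrees with a skew-symmetric one. *)
Lemma det_even_symmetric_odd n (A : 'M[int]_n) : odd n -> A^T = A ->
  (forall i, (2 %| A i i)%Z) -> (2 %| \det A)%Z.
Proof.
move=> n_odd A_sym A_even.
pose S : 'M[int]_n := \matrix_(i, j)
  if (i < j)%N then A i j else if (j < i)%N then - A i j else 0.
have S_skew : S^T = - S.
  apply/matrixP => i j; rewrite !mxE; have Aji : A j i = A i j by rewrite -[in LHS]A_sym mxE.
  by case: (ltngtP i j) => // _; rewrite ?Aji ?opprK ?oppr0.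
have S0 : \det S = 0.
  have : \det S = - \det S.
    rewrite -{1}det_tr S_skew -scaleN1r detZ -signr_odd n_odd expr1; ring.
  lia.
have pch2 : 2%N \in [pchar 'F_2] by exact: pchar_Fp.
rewrite (dvdz_pcharf pch2) -(det_map_mx intr).
have -> : map_mx intr A = map_mx intr S :> 'M['F_2]_n.
  apply/matrixP => i j; rewrite !mxE; case: ltngtP => // [_|ij].
    by rewrite rmorphN /= -[RHS]addr0 -[X in - _ + X](addrr_pchar2 pch2 (A i j)%:~R) addrA addNr add0r.
  by rewrite (ord_inj ij); apply/eqP; rewrite -(dvdz_pcharf pch2).
by rewrite det_map_mx S0.
Qed.

(** In a Smith form [P D Q] the unimodular [Q] does not change the integer column span, and the
    nonzero columns of [P D] are independent. *)
Lemma int_column_basis (F : numFieldType) n m (M : 'M[int]_(n, m)) :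
  exists r (B : 'M[int]_(n, r)), \rank (map_mx intr B : 'M[F]_(n, r)) = r /\
  forall u : 'cV[int]_n,
    (exists z : 'cV_m, u = M *m z) <-> (exists z : 'cV_r, u = B *m z).
Proof.
have [P Pu [Q Qu [d _ ->]]] := int_Smith_normal_form M.
set D := \matrix_(i, j) _.
(* A column of the rectangular [D] is nonzero only if its diagonal place exists, [j < n], and holds
   a nonzero entry. *)
pose S := [set j : 'I_m | (j < n)%N && (d`_j != 0)]%SET.
pose f (k : 'I_#|S|) : 'I_m := enum_val k.
have fS k : (f k < n)%N && (d`_(f k) != 0) by have := enum_valP k; rewrite inE.
pose D' := \matrix_(i < n, k < #|S|) D i (f k).
exists #|S|, (P *m D'); split.
  (* A left inverse of [D'] over the field. *)
  pose E : 'M[F]_(#|S|, n) := \matrix_(k, i) if (i == f k :> nat) then (d`_(f k))%:~R^-1 else 0.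
  have ED : (E *m invmx (map_mx intr P)) *m map_mx intr (P *m D') *m 1%:M = 1%:M.
    rewrite mulmx1 map_mxM mulmxA -(mulmxA E) mulVmx ?mulmx1; last first.
      by rewrite unitmxE det_map_mx rmorph_unit // -unitmxE.
    apply/matrixP => k k'; rewrite !mxE.
    have /andP[lt_n dk] := fS k.
    rewrite (bigD1 (Ordinal lt_n)) //= big1 ?addr0 => [|i ik]; last first.
      rewrite !mxE; case: eqP => ik'; last by rewrite mul0r.
      by case/eqP: ik; apply: val_inj.
    rewrite !mxE /= eqxx; case: eqP => kk'.
      have -> : k' = k by apply: enum_val_inj; apply: val_inj.
      by rewrite eqxx mulVf // intr_eq0.
    rewrite mulr0n mulr0; case: eqP => // kk; by rewrite kk in kk'.
  by apply/eqP; rewrite eqn_leq rank_leq_col (mulmx1_min_rank ED).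
move=> u; split=> -[z ->].
  exists (\col_k (Q *m z) (f k) 0); rewrite -!mulmxA; congr (_ *m _).
  apply/matrixP => i j; rewrite !mxE ord1 {j}.
  transitivity (\sum_(j in S) D i j * (Q *m z) j 0).
    rewrite [LHS](bigID (mem S)) /= [X in _ + X]big1 ?addr0 // => j.
    rewrite inE negb_and -leqNgt negbK => jS; rewrite mxE.
    case: eqP => [ij|_]; last by rewrite mulr0n mul0r.
    move: jS; rewrite -ij leqNgt ltn_ord /= ij => /eqP ->.
    by rewrite mul0rn mul0r.
  by rewrite big_enum_val; apply: eq_bigr => k _; rewrite !mxE.
exists (invmx Q *m \col_j \sum_(k | f k == j) z k 0).
rewrite -!mulmxA mulKVmx //; congr (_ *m _).
apply/matrixP => i j; rewrite !mxE ord1 {j}.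
rewrite (partition_big f predT) //=; apply: eq_bigr => j _.
rewrite [X in _ = _ * X]mxE mulr_sumr; apply: eq_bigr => k /eqP <-; by rewrite !mxE.
Qed.

End IntegerMatrices.

Section Gram.
Variables (R : realType) (n r : nat) (B : 'M[R]_(n, r)).
Hypothesis B_rank : \rank B = r.

Lemma full_rank_mul_eq0 (x : 'cV[R]_r) : B *m x = 0 -> x = 0.
Proof.
move=> Bx; apply: trmx_inj; rewrite trmx0.
have free : row_free B^T by rewrite /row_free mxrank_tr B_rank.
apply: (row_free_inj free); rewrite mul0mx -trmx_mul Bx trmx0.
by [].
Qed.

(* The determinant does not vanish on the segment from the identity to the Gram
   matrix. *)
Lemma det_gram_gt0 : 0 < \det (B^T *m B).
Proof.
pose p : {poly R} := \det (\matrix_(i, j)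
  ((i == j)%:R%:P + 'X * ((B^T *m B) i j - (i == j)%:R)%:P)).
have pE t : p.[t] = \det ((1 - t)%:M + t *: (B^T *m B)).
  rewrite -[LHS]/(horner_eval t p) -det_map_mx; congr (\det _).
  apply/matrixP => i j; rewrite !mxE /= /horner_eval !hornerE.
  by case: (i == j) => /=; rewrite ?mulr1n ?mulr0n; ring.
have p_neq0 t : 0 <= t <= 1 -> p.[t] != 0.
  move=> /andP[t0 t1]; rewrite pE; apply/det0P => -[x x0].
  move=> /(congr1 (fun y => (y *m x^T) 0 0)).
  rewrite mulmxDr mulmxDl mul_mx_scalar -scalemxAl -scalemxAr -scalemxAl.
  rewrite mul0mx !mxE -/(dot _ _).
  have -> : \sum_j x 0 j * x^T j 0 = sqnorm x^T.
    by apply: eq_bigr => j _; rewrite !mxE.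
  have -> : \sum_j (x *m (B^T *m B)) 0 j * x^T j 0 = sqnorm (B *m x^T).
    rewrite /sqnorm -dot_mulmx trmx_mul trmxK !mulmxA.
    by rewrite [RHS]mxE.
  have xT0 : sqnorm x^T <> 0.
    by move=> /sqnorm_eq0/eqP; rewrite trmx_eq0 (negbTE x0).
  have BxT0 : sqnorm (B *m x^T) <> 0.
    by move=> /sqnorm_eq0/full_rank_mul_eq0/eqP; rewrite trmx_eq0 (negbTE x0).
  have := sqnorm_ge0 x^T; rewrite le_eqVlt => /orP[/eqP/esym //|x_gt0].
  have := sqnorm_ge0 (B *m x^T); rewrite le_eqVlt => /orP[/eqP/esym //|Bx_gt0].
  nra.
have p1 : p.[1] = \det (B^T *m B) by rewrite pE subrr scale1r raddf0 add0r.
have p0 : p.[0] = 1 by rewrite pE subr0 scale0r addr0 det1.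
rewrite ltNge -p1; apply/negP => le0.
have [|t t01 /rootP pt] := @poly_ivt _ (- p) 0 1 ler01.
  by rewrite !hornerN p0 oppr_ge0 oppr_le0 ler01 le0.
by have /eqP := p_neq0 t t01; apply; move: pt; rewrite hornerN => /eqP; rewrite oppr_eq0 => /eqP.
Qed.

End Gram.

Lemma intr_mx_inj (R : numDomainType) m n :
  injective (map_mx intr : 'M[int]_(m, n) -> 'M[R]_(m, n)).
Proof.
move=> A B /matrixP AB; apply/matrixP => i j.
by have := AB i j; rewrite !mxE => /intr_inj.
Qed.

(** * Adjoining one vector to a lattice *)

Section BorderedGram.
Variables (R : realType) (n r : nat) (B : 'M[R]_(n, r)) (G : 'M[int]_r).
Hypothesis B_rank : \rank B = r.
Hypothesis GB : map_mx intr G = B^T *m B.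
Variables (u : 'cV[R]_n) (h : 'cV[int]_r) (m : nat) (z0 : 'cV[int]_r) (k0 : int).
Hypothesis m_gt0 : (0 < m)%N.
Hypothesis hB : map_mx intr h = B^T *m u.
Hypothesis z0B : u *+ m = B *m map_mx intr z0.
Hypothesis k0u : k0%:~R = sqnorm u + m%:R^-1.

(* The Gram matrix of the columns of [B] together with [u + s], where [s] is
   orthogonal to everything and [(s, s) = 1 / m]. *)
Definition bordered_gram : 'M[int]_(r + 1) := block_mx G h h^T k0%:M.

Lemma bordered_gram_sym : bordered_gram^T = bordered_gram.
Proof.
rewrite /bordered_gram tr_block_mx trmxK tr_scalar_mx; congr block_mx.
apply: (@intr_mx_inj R).
by rewrite -map_trmx GB trmx_mul trmxK.
Qed.

Let mR : m%:R != 0 :> R. Proof. by rewrite pnatr_eq0 -lt0n. Qed.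

(** Since [m u] is in the lattice, [u] is a real combination [B xi]. Subtracting it from the last
    vector leaves [s], orthogonal to the columns of [B] and of norm [1 / m]; [T] is this column
    operation. *)
Lemma det_bordered_gram : (\det bordered_gram)%:~R = \det (B^T *m B) / m%:R.
Proof.
pose xi : 'cV[R]_r := m%:R^-1 *: map_mx intr z0.
have uB : u = B *m xi.
  by rewrite -scalemxAr -z0B -scaler_nat scalerA mulVf // scale1r.
have hG : map_mx intr h = B^T *m B *m xi by rewrite hB {1}uB mulmxA.
pose T : 'M[R]_(r + 1) := block_mx 1%:M (- xi) 0 1%:M.
have detT : \det T = 1 by rewrite det_ublock !det1 mulr1.
rewrite -det_map_mx -[LHS]mulr1 -[X in _ * X = _]detT -det_mulmx map_block_mx mulmx_block GB hG.
rewrite !mulmx1 !mulmx0 !addr0 mulmxN addNr.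
rewrite det_lblock; congr (_ * _); rewrite det_mx11 -map_trmx hG map_scalar_mx.
rewrite mxE mulmxN mxE trmx_mul trmx_mul trmxK.
rewrite !mulmxA -(mulmxA (xi^T *m B^T)) -trmx_mul -uB dot_mulmx.
by rewrite mxE eqxx mulr1n /= k0u /sqnorm; ring.
Qed.

(** If [mu] carries each dual vector of the lattice into the lattice plus multiples of [u], then
    [mu] also kills the discriminant group of the bordered lattice. As an integral matrix [Z] this
    restricts the bordered determinant. *)
Lemma bordered_gram_mul (mu : int) :
  (forall w : 'cV[R]_n, (exists x, w = B *m x) ->
     (forall i, (B^T *m w) i 0 \is a Num.int) ->
     exists (z : 'cV[int]_r) (j : int), w *~ mu = B *m map_mx intr z + u *~ j) ->
  exists Z, bordered_gram *m Z = mu%:M.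
Proof.
move=> dual.
have G_unit : B^T *m B \in unitmx by rewrite unitmxE unitfE gt_eqF ?det_gram_gt0.
have solve (y : 'cV[int]_(r + 1)) : exists x, bordered_gram *m x = y *~ mu.
  pose w := B *m (invmx (B^T *m B) *m map_mx intr (usubmx y)).
  have Bw : B^T *m w = map_mx intr (usubmx y) by rewrite mulmxA mulKVmx.
  have [|i|z [j wz]] := dual w; first by exists (invmx (B^T *m B) *m map_mx intr (usubmx y)).
    by rewrite Bw mxE intr_int.
  (* The vector [m s] has coordinates [(- z0, m)], is orthogonal to the columns of [B] and has
     product 1 with [u + s]. Adding [k] times it to [(z, j)] corrects only the last entry. *)
  pose k := mu * y (rshift r 0) 0 - (h^T *m z) 0 0 - k0 * j.
  exists (col_mx (z - z0 *~ k) (j + m%:Z * k)%:M).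
  rewrite -[y in RHS]vsubmxK -[RHS]scaler_int scale_col_mx /bordered_gram mul_block_col.
  congr col_mx.
    apply: (@intr_mx_inj R).
    transitivity (B^T *m (w *~ mu)); last first.
      by rewrite -scaler_int -scalemxAr Bw map_mxZ /= intz.
    rewrite map_mxD !map_mxM map_mxB GB hB wz /=.
    have -> : map_mx intr (z0 *~ k) = k%:~R *: map_mx intr z0 :> 'cV[R]_r.
      by rewrite -scaler_int map_mxZ /= intz.
    rewrite map_scalar_mx mul_mx_scalar -!mulmxA scalemxAr -mulmxDr; congr (_ *m _).
    rewrite mulmxBr -scalemxAr -z0B -[u *~ _]scaler_int -[u *+ m]scaler_nat scalerA /= intrD intrM.
    by rewrite scalerDl [k%:~R * _]mulrC addrACA addNr addr0.
  apply: (@intr_mx_inj R); apply/matrixP => i j'; rewrite !ord1 {i j'}.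
  rewrite map_mxD !map_mxM map_mxB -map_trmx hB !map_scalar_mx mul_scalar_mx scale_scalar_mx.
  have -> : map_mx intr (z0 *~ k) = k%:~R *: map_mx intr z0 :> 'cV[R]_r.
    by rewrite -scaler_int map_mxZ /= intz.
  rewrite trmx_mul trmxK -mulmxA mulmxBr -scalemxAr -z0B -[u *+ m]scaler_nat scalerA.
  rewrite mxE dot_mulmx dotBr dotZr -/(sqnorm u).
  have hz : ((h^T *m z) 0 0)%:~R = dot u (B *m map_mx intr z) :> R.
    transitivity (map_mx intr (h^T *m z) 0 0 : R); first by rewrite [RHS]mxE.
    by rewrite map_mxM -map_trmx hB trmx_mul trmxK -mulmxA dot_mulmx.
  have kE : k%:~R = mu%:~R * (y (rshift r 0) 0)%:~R
      - dot u (B *m map_mx intr z) - k0%:~R * j%:~R :> R.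
    by rewrite /k !rmorphB !rmorphM /= hz.
  have -> : map_mx intr (mu%:~R *: dsubmx y) 0 0 = mu%:~R * (y (rshift r 0) 0)%:~R :> R.
    by rewrite mxE [X in X%:~R]mxE [X in (_ * X)%:~R]mxE rmorphM /= intz.
  rewrite mxE eqxx mulr1n /= intrD intrM.
  have -> : mu%:~R * (y (rshift r 0) 0)%:~R = k%:~R
      + dot u (B *m map_mx intr z) + k0%:~R * j%:~R :> R by rewrite kE; ring.
  by rewrite -pmulrn k0u; field; exact: mR.
have [X solX] := choice solve.
exists (\matrix_(i, j) X (delta_mx j 0) i 0).
apply/matrixP => i j; rewrite !mxE.
transitivity ((bordered_gram *m X (delta_mx j 0)) i 0).
  by rewrite mxE; apply: eq_bigr => k _; rewrite mxE.
by rewrite solX -scaler_int !mxE eqxx andbT intz mulr_natr.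
Qed.

End BorderedGram.

(** In a rank factorization [E = C R], idempotence forces [R C = 1], and the trace of [C R] is that
    of [R C]. *)
Lemma mxrank_idempotent (F : numFieldType) n (E : 'M[F]_n) :
  E *m E = E -> (\rank E)%:R = \tr E.
Proof.
move=> EE; have base := mulmx_base E.
have CR : row_base E *m col_base E = 1%:M.
  apply: (row_full_inj (col_base_full E)); apply: (row_free_inj (row_base_free E)) => /=.
  transitivity ((col_base E *m row_base E) *m (col_base E *m row_base E)).
    by rewrite !mulmxA.
  by rewrite mulmx1 base.
by rewrite -[in RHS]base mxtrace_mulC CR mxtrace1.
Qed.

(** * Rank, determinant and minimum *)

Section RankAndDeterminant.
Variables (R : realType) (X Y : finType) (inc : X -> Y -> bool).
Hypothesis hexH : generalized_hexagon inc.
Hypothesis orderH : has_order inc 2 8.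

Notation g := (kernel R hexH).
Notation v := (hexagon_vector R inc).
Notation L := (hexagon_lattice R inc).
Notation coef := (@coef R X Y inc).
Notation hspan := (@hspan R X Y inc).
Notation integral_dual := (@integral_dual R X Y inc).

Let n := #|X|.
Let V : 'M[R]_n := Num.sqrt 84 *: idem26 R inc.

Lemma vector_col x : v x = V *m delta_mx (enum_rank x) 0.
Proof. by rewrite -scalemxAl. Qed.

Lemma mulmx_vectors (y : 'cV[R]_n) : V *m y = \sum_x y (enum_rank x) 0 *: v x.
Proof.
have -> : y = \sum_x y (enum_rank x) 0 *: delta_mx (enum_rank x) 0.
  rewrite [LHS]matrix_sum_delta; under eq_bigr do rewrite big_ord1.
  rewrite (reindex (@enum_rank X)) //=.
  by exists enum_val => i _; [exact: enum_rankK|exact: enum_valK].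
rewrite mulmx_sumr; apply: eq_bigr => x _; rewrite -scalemxAr -vector_col; congr (_ *: _).
rewrite summxE (bigD1 x) //= big1 ?addr0 => [|z zx]; rewrite !mxE ?eqxx ?mulr1 //.
by rewrite (inj_eq enum_rank_inj) eq_sym (negbTE zx) mulr0.
Qed.

Lemma hspanE w : hspan w <-> exists y, w = V *m y.
Proof.
split=> [[a ->]|[y ->]]; last by exists (fun x => y (enum_rank x) 0); exact: mulmx_vectors.
exists (\col_i a (enum_val i)); rewrite mulmx_vectors.
by apply: eq_bigr => x _; rewrite mxE enum_rankK.
Qed.

Lemma lattice_mulmx u : L u <->
  exists2 a : 'cV[int]_n, (3 %| \sum_i a i ord0)%Z & u = V *m map_mx intr a.
Proof.
have sumE (f : X -> int) : \sum_(i < n) f (enum_val i) = \sum_x f x.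
  rewrite [RHS](reindex (@enum_val X predT)) //=.
  by exists enum_rank => z _; [exact: enum_valK|exact: enum_rankK].
split=> [[a [a3 ->]]|[a a3 ->]].
  exists (\col_i a (enum_val i)); first by under eq_bigr do rewrite mxE; rewrite sumE.
  by rewrite mulmx_vectors; apply: eq_bigr => x _; rewrite !mxE enum_rankK scaler_int.
exists (fun x => a (enum_rank x) 0); split.
  by rewrite -sumE; under eq_bigr do rewrite enum_valK.
by rewrite mulmx_vectors; apply: eq_bigr => x _; rewrite mxE scaler_int.
Qed.

Lemma rank_vectors : \rank V = 26%N.
Proof.
have s84 : Num.sqrt 84 != 0 :> R by rewrite sqrtr_eq0 -ltNge ltr0n.
rewrite mxrank_scale_nz //; apply/eqP; rewrite -(eqr_nat R) mxrank_idempotent.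
  rewrite /mxtrace; under eq_bigr do rewrite idem26E // kernel_diag.
  rewrite sumr_const card_ord -[_ *+ #|X|]mulr_natl (card_points R hexH orderH).
  by apply/eqP; field.
apply/matrixP => i j; rewrite mxE idem26E //.
have rep : \sum_y g (enum_val i) y * g (enum_val j) y = 84 * g (enum_val j) (enum_val i).
  by apply: kernel_reproducing => //; exact: kernel_line_sum.
transitivity ((\sum_y g (enum_val i) y * g (enum_val j) y) / 84 ^+ 2); last first.
  by rewrite rep kernel_sym; field.
rewrite mulr_suml [RHS](reindex (@enum_val X predT)) /=; last first.
  by exists enum_rank => z _; [exact: enum_valK|exact: enum_rankK].
by apply: eq_bigr => k _; rewrite !(idem26E R hexH) [g (enum_val j) _]kernel_sym; field.
Qed.

Lemma lattice_basis_col r (B : 'M[R]_(n, r)) j : lattice_basis L B -> L (col j B).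
Proof. by move=> [_ ->]; exists (delta_mx j 0) => //; rewrite colE map_delta_mx. Qed.

Lemma lattice_basis_hspan r (B : 'M[R]_(n, r)) w : lattice_basis L B ->
  hspan w <-> exists x, w = B *m x.
Proof.
move=> LB; split=> [[a ->]|[x ->]].
  have Bv x : exists z : 'cV[R]_r, v x = B *m z.
    have := lattice_vector3 R inc x; rewrite {1}LB.2 => -[z _ vz].
    exists (3^-1 *: map_mx intr z).
    by rewrite -scalemxAr vz -scaler_int scalerA mulVf ?scale1r // pnatr_eq0.
  have [z vz] := choice Bv; exists (\sum_x a x *: z x).
  by rewrite mulmx_sumr; apply: eq_bigr => x _; rewrite -scalemxAr -vz.
have -> : B *m x = \sum_j x j 0 *: col j B.
  apply/matrixP => i k; rewrite ord1 mxE summxE; apply: eq_bigr => j _.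
  by rewrite !mxE mulrC.
elim/big_ind: _ => [|a b|j _]; [exact: hspan0|exact: hspanD|].
by apply: hspanZ; apply: lattice_hspan; exact: lattice_basis_col.
Qed.

Lemma lattice_basis_rank r (B : 'M[R]_(n, r)) : lattice_basis L B -> r = 26%N.
Proof.
move=> LB; rewrite -rank_vectors -LB.1.
have sub m m' (C : 'M[R]_(n, m)) (D : 'M[R]_(n, m')) :
    (forall j, exists x, col j C = D *m x) -> (\rank C <= \rank D)%N.
  move=> /choice[x CX]; have -> : C = D *m \matrix_(i, j) x j i 0.
    apply/matrixP => i j; have /matrixP/(_ i 0) := CX j; rewrite !mxE => ->.
    by apply: eq_bigr => k _; rewrite mxE.
  exact: mxrankM_maxl.
apply/eqP; rewrite eqn_leq !sub //= => j.
  by apply/(lattice_basis_hspan _ LB)/hspanE; exists (delta_mx j 0); rewrite colE.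
by apply/hspanE/(lattice_basis_hspan _ LB); exists (delta_mx j 0); rewrite colE.
Qed.

Lemma exists_lattice_basis : exists r (B : 'M[R]_(n, r)), lattice_basis L B.
Proof.
have [x0 _] := exists_point hexH orderH; pose i0 := enum_rank x0.
pose M : 'M[int]_n := \matrix_(i, j)
  nth 0 [:: 8; - 4; 2; - 1] (point_dist hexH (enum_val i) (enum_val j)).
(* Here [252 = 3 * 84]: the idempotent is the kernel over 84, and the kernel is [M / 3]. *)
pose k : R := Num.sqrt 84 / 252.
have k0 : k != 0 by rewrite mulf_neq0 ?invr_eq0 ?pnatr_eq0 // sqrtr_eq0 -ltNge ltr0n.
have VM : V = k *: map_mx intr M.
  apply/matrixP => i j; rewrite mxE idem26E // kernel_dist !mxE /k.
  have := point_dist_le3 hexH (enum_val i) (enum_val j).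
  by case: point_dist => [|[|[|[|//]]]] _ /=; field.
pose e0 : 'cV[int]_n := delta_mx i0 0.
(* The columns of [T] generate the coefficient vectors with sum divisible by 3: the first block
   brings the sum to 0 by changing the entry at [i0], the last column adds multiples of 3 there. *)
pose T : 'M[int]_(n, n + 1) := row_mx (1%:M - e0 *m const_mx 1) (3 *: e0).
have TE z : T *m z = usubmx z - (\sum_i usubmx z i ord0) *: e0 + (3 * dsubmx z 0 0) *: e0.
  rewrite -[z in LHS]vsubmxK mul_row_col mulmxBl mul1mx -mulmxA -scalemxAl.
  have -> : const_mx 1 *m usubmx z = (\sum_i usubmx z i ord0)%:M :> 'M_1.
    apply/matrixP => i j; rewrite !ord1 !mxE eqxx mulr1n.
    by apply: eq_bigr => k' _; rewrite !mxE mul1r.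
  by rewrite mul_mx_scalar {1}[dsubmx z]mx11_scalar mul_mx_scalar scalerA.
have sum_e0 (a : int) : \sum_i (a *: e0) i ord0 = a.
  rewrite (bigD1 i0) //= big1 => [|i ii0]; rewrite !mxE ?eqxx ?mulr1 ?addr0 //.
  by rewrite (negbTE ii0) mulr0.
have range_T (a : 'cV[int]_n) : (3 %| \sum_i a i ord0)%Z <-> exists z, a = T *m z.
  split=> [/dvdzP[q aq]|[z ->]].
    exists (col_mx a q%:M); rewrite TE col_mxKu col_mxKd aq mxE eqxx mulr1n.
    by rewrite [3 * q]mulrC subrK.
  rewrite TE; under eq_bigr do rewrite mxE [X in X + _]mxE [X in _ + X + _]mxE.
  by rewrite big_split sumrB /= !sum_e0 subrr add0r dvdz_mulr.
have [r [B [rB MTB]]] := int_column_basis R (M *m T).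
exists r, (k *: map_mx intr B); split; first by rewrite mxrank_scale_nz.
apply/seteqP; split=> u /=.
  move=> /lattice_mulmx[a /range_T[z ->] ->].
  have [z' Bz] := (MTB (M *m T *m z)).1 (ex_intro _ z erefl).
  by exists z' => //; rewrite -scalemxAl -map_mxM -Bz VM -scalemxAl -!map_mxM mulmxA.
move=> [z _ <-]; have [z' MTz] := (MTB (B *m z)).2 (ex_intro _ z erefl).
apply/lattice_mulmx; exists (T *m z'); first by apply/range_T; exists z'.
by rewrite -scalemxAl -map_mxM MTz VM -scalemxAl -!map_mxM mulmxA.
Qed.

Lemma hexagon_lattice_rank : lattice_rank L 26.
Proof.
have [r [B LB]] := exists_lattice_basis.
by have r26 := lattice_basis_rank LB; subst r; exists B.
Qed.

End RankAndDeterminant.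

(** * The determinant and the minimum *)

Section Determinant.
Variables (R : realType) (X Y : finType) (inc : X -> Y -> bool).
Hypothesis hexH : generalized_hexagon inc.
Hypothesis orderH : has_order inc 2 8.

Notation g := (kernel R hexH).
Notation v := (hexagon_vector R inc).
Notation L := (hexagon_lattice R inc).
Notation coef := (@coef R X Y inc).
Notation hspan := (@hspan R X Y inc).
Notation integral_dual := (@integral_dual R X Y inc).
Notation n := #|X|.

Section Basis.
Variables (r : nat) (B : 'M[R]_(n, r)).
Hypothesis LB : lattice_basis L B.

Lemma mem_lattice_basis u : L u <-> exists z : 'cV[int]_r, u = B *m map_mx intr z.
Proof. by rewrite LB.2; split=> [[z _ <-]|[z ->]]; exists z. Qed.

Lemma gram_entry i j : (B^T *m B) i j = dot (col i B) (col j B).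
Proof. by rewrite mxE; apply: eq_bigr => k _; rewrite !mxE. Qed.

Lemma mulmx_entry w i : (B^T *m w) i 0 = dot (col i B) w.
Proof. by rewrite mxE; apply: eq_bigr => k _; rewrite !mxE. Qed.

Lemma exists_int_gram : exists G : 'M[int]_r,
  map_mx intr G = B^T *m B /\ forall i, (2 %| G i i)%Z.
Proof.
have Lc j := lattice_basis_col j LB.
have [f fE] := choice (fun p : 'I_r * 'I_r =>
  lattice_integral hexH orderH (Lc p.1) (Lc p.2)).
exists (\matrix_(i, j) f (i, j)); split.
  by apply/matrixP => i j; rewrite gram_entry mxE [X in X%:~R]mxE -fE.
move=> i; rewrite mxE; have [k kE] := lattice_even hexH orderH (Lc i).
have : f (i, i) = 2 * k by apply: (@intr_inj R); rewrite -fE -kE.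
by move=> ->; rewrite dvdz_mulr.
Qed.

Lemma exists_int_products u : (forall l, L l -> dot l u \is a Num.int) ->
  exists h : 'cV[int]_r, map_mx intr h = B^T *m u.
Proof.
move=> du; have ex j : exists k : int, dot (col j B) u = k%:~R.
  by apply/intrP; apply: du; exact: lattice_basis_col.
have [f fE] := choice ex; exists (\col_j f j).
by apply/matrixP => i j; rewrite ord1 mulmx_entry mxE [X in X%:~R]mxE -fE.
Qed.

Lemma int_products_dual w : (forall i, (B^T *m w) i 0 \is a Num.int) ->
  forall l, L l -> dot w l \is a Num.int.
Proof.
move=> wi l /mem_lattice_basis[z ->].
rewrite -dot_mulmx mulmxA -[w^T *m B]trmxK trmx_mul trmxK.
rewrite mxE rpred_sum // => i _; rewrite mxE rpredM // mxE ?intr_int //.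
Qed.

End Basis.

(** The elements of [M] outside [L], which [no_defect] shows not to exist. *)
Definition short_defect u := integral_dual u /\ ~ L u.

(** Subtracting a lattice vector leads to a reduced vector of norm [7 / 2]. It changes the norm by
    an even integer, since the lattice is even and its products with [u] are integers. *)
Lemma sqnorm_defect u : short_defect u ->
  exists k : int, sqnorm u = 7 / 2 + 2 * k%:~R.
Proof.
move=> [du Nu]; have [l Ll red] := exists_reduced hexH orderH du.
have [u0|ul] := reduced_norm hexH orderH red.
  by case: Nu; rewrite (subr0_eq u0).
have [k kE] := lattice_even hexH orderH Ll.
have /intrP[j jE] := integral_dual_dot red.1 Ll.
by exists (j + k); rewrite -[u](subrK l) sqnormD ul jE kE; field.
Qed.

Lemma half_odd_not_int (a b c : int) : 7 / 2 + a%:~R = b%:~R + c%:~R :> R -> False.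
Proof.
move=> E; have : (7 + 2 * a)%:~R = (2 * (b + c))%:~R :> R.
  have -> : (2 * (b + c))%:~R = 2 * (b%:~R + c%:~R) :> R by field.
  by rewrite -E; field.
by move/intr_inj; lia.
Qed.

(** Outside the lattice [u + u] would have norm [7 / 2] modulo 2, but its norm is
    [4 * (7 / 2 + 2 k)], an integer. *)
Lemma defect_double u : short_defect u -> L (u + u).
Proof.
move=> Du; apply: contrapT => N2u.
have [k kE] := sqnorm_defect Du.
have [|j] := @sqnorm_defect (u + u); first by split=> //; apply: integral_dualD Du.1 Du.1.
rewrite sqnormD -/(sqnorm u) kE => E.
apply: (@half_odd_not_int (2 * j) 14 (8 * k)).
rewrite (_ : 7 / 2 + (2 * j)%:~R = 7 / 2 + 2 * j%:~R); last by field.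
by rewrite -E; field.
Qed.

(** Outside the lattice [u - w] would have norm [7 / 2] modulo 2. But [2 * dot u w] is the product
    of [u] with the lattice vector [w + w], so the norm of [u - w] is an integer. *)
Lemma defectB u w : short_defect u -> short_defect w -> L (u - w).
Proof.
move=> Du Dw; apply: contrapT => Nuw.
have [k kE] := sqnorm_defect Du; have [j jE] := sqnorm_defect Dw.
have /intrP[i iE] := integral_dual_dot Du.1 (defect_double Dw).
have [|m] := @sqnorm_defect (u - w); first by split=> //; apply: integral_dualB Du.1 Dw.1.
rewrite dotDr in iE; rewrite sqnormB kE jE => E.
apply: (@half_odd_not_int (2 * m) (7 - i) (2 * (k + j))).
rewrite (_ : 7 / 2 + (2 * m)%:~R = 7 / 2 + 2 * m%:~R); last by field.
rewrite -E rmorphB /= -iE; by field.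
Qed.

Lemma dual_lattice_coef w : (forall l, L l -> dot w l \is a Num.int) -> hspan w ->
  integral_dual (w *~ 3).
Proof.
move=> dw sw; split; first by rewrite -scaler_int; exact: hspanZ.
move=> x; rewrite /(coef _ _) -scaler_int dotZl -dotZr scaler_int.
by apply: dw; exact: lattice_vector3.
Qed.

Lemma no_defect u : integral_dual u -> L u.
Proof.
move=> du; apply: contrapT => Nu.
have [l Ll red] := exists_reduced hexH orderH du.
have Dw : short_defect (u - l).
  by split=> [|Lul]; [exact: red.1|case: Nu; rewrite -[u](subrK l); exact: latticeD].
have wN : sqnorm (u - l) = 7 / 2.
  by have [w0|//] := reduced_norm hexH orderH red; case: Dw.2; rewrite w0; exact: lattice0.
set w := u - l in Dw wN red.
have [r [B LB]] := exists_lattice_basis R hexH orderH.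
have r26 := lattice_basis_rank hexH orderH LB; subst r.
have [G [GB Geven]] := exists_int_gram LB.
have [h hB] : exists h : 'cV[int]_26, map_mx intr h = B^T *m w.
  by apply: (exists_int_products LB) => l' Ll'; rewrite dotC; exact: integral_dual_dot Dw.1 Ll'.
have [z0 z0B] := (mem_lattice_basis LB _).1 (defect_double Dw).
(* The border has [m = 2] because [2 w] is in the lattice, and [7 / 2 + 1 / 2 = 4] is even. The
   multiplier is 3: three times a dual vector lies in [M], which is contained in the union of [L]
   and [w + L]. *)
have kE : (4 : int)%:~R = sqnorm w + 2%:R^-1 :> R by rewrite wN; field.
have [|Z ZE] := bordered_gram_mul (m := 2) LB.1 GB isT hB z0B kE (mu := 3).
  move=> w' [x w'x] /(int_products_dual LB) dw'.
  have sw' : hspan w' by apply/(lattice_basis_hspan _ LB); exists x.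
  have dw3 := dual_lattice_coef dw' sw'.
  have [L3|N3] := pselect (L (w' *~ 3)).
    have [z zE] := (mem_lattice_basis LB _).1 L3.
    by exists z, 0; rewrite mulr0z addr0.
  have [z zE] := (mem_lattice_basis LB _).1 (@defectB _ _ (conj dw3 N3) Dw).
  by exists z, 1; rewrite mulr1z -zE subrK.
have det2 : (2 %| \det (bordered_gram G h 4))%Z.
  apply: det_even_symmetric_odd => //.
    exact: bordered_gram_sym GB _ _.
  move=> i; rewrite /bordered_gram; case: (split_ordP i) => j ->.
    by rewrite block_mxEul.
  by rewrite block_mxEdr ord1 mxE eqxx.
(* The even determinant would divide [3 ^ 27]. *)
have := congr1 determinant ZE; rewrite det_mulmx det_scalar => E.
have : (2 %| (3 : int) ^+ (26 + 1))%Z by rewrite -E dvdz_mulr.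
by rewrite dvdzE abszX dvdn2 oddX.
Qed.

Lemma hexagon_lattice_det : lattice_det L 3.
Proof.
split; first by exact: (exists_lattice_basis R hexH orderH).
move=> r B LB; have [G [GB _]] := exists_int_gram LB.
have [x0 _] := exists_point hexH orderH.
have v0N := sqnorm_hexagon_vector R hexH orderH x0.
have [h hB] : exists h : 'cV[int]_r, map_mx intr h = B^T *m v x0.
  apply: (exists_int_products LB) => l Ll.
  exact: (lattice_integral_dual hexH orderH Ll).2.
have [z0 z0B] := (mem_lattice_basis LB _).1 (lattice_vector3 R inc x0).
have kE : (3 : int)%:~R = sqnorm (v x0) + 3%:R^-1 :> R by rewrite v0N; field.
have [|Z ZE] := bordered_gram_mul (m := 3) LB.1 GB isT hB z0B kE (mu := 1).
  move=> w [x wx] /(int_products_dual LB) dw.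
  have sw : hspan w by apply/(lattice_basis_hspan _ LB); exists x.
  have [_ dw3] := dual_lattice_coef dw sw.
  have /intrP[p pE] := dw3 x0.
  (* Modulo 1 the entries of [w] are all [p / 3] and those of [v x0] all [2 / 3], so this sum has
     integral entries and [no_defect] applies. *)
  have Ld : L (w + v x0 *~ p).
    apply: no_defect; split.
      by apply: hspanD => //; rewrite -scaler_int; apply: hspanZ; exact: hspan_vector.
    move=> y; rewrite coefD -scaler_int coefZ coef_vector //.
    have /intrP[q qE] := dw _ (lattice_vectorB R inc y x0).
    have /intrP[m mE] := kernel_mod1 R hexH x0 y.
    move: pE; rewrite -scaler_int coefZ => pE.
    rewrite dotBr -!/(coef w _) in qE.
    have -> : coef w y + p%:~R * g x0 y = q%:~R + p%:~R * (m + 1)%:~R.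
      have -> : coef w y = q%:~R + coef w x0 by rewrite -qE subrK.
      have -> : coef w x0 = p%:~R / 3 by rewrite -pE; field.
      have -> : g x0 y = 2 / 3 + m%:~R by rewrite -mE; field.
      by field.
    by rewrite rpredD ?rpredM ?intr_int.
  have [z zE] := (mem_lattice_basis LB _).1 Ld.
  by exists z, (- p); rewrite mulr1z -zE mulrNz addrK.
have detB := det_bordered_gram (m := 3) GB isT hB z0B kE.
have := congr1 determinant ZE; rewrite det_mulmx det_scalar expr1n => dZ.
have := det_gram_gt0 LB.1.
have -> : \det (B^T *m B) = 3 * (\det (bordered_gram G h 3))%:~R.
  by rewrite detB mulrC divfK // pnatr_eq0.
rewrite pmulr_rgt0 // ltr0z => det_gt0.
suff -> : \det (bordered_gram G h 3) = 1 by rewrite mulr1.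
move: dZ det_gt0; move: (\det (bordered_gram G h 3)) (\det Z) => a b ab a0.
have b0 : 0 < b by rewrite -(pmulr_rgt0 _ a0) ab.
by have : 0 <= (a - 1) * (b - 1); [rewrite mulr_ge0 // subr_ge0|lia].
Qed.

Lemma hexagon_lattice_min : lattice_min L 4.
Proof.
split.
  have [x _] := exists_point hexH orderH.
  have [y dxy] : exists y, point_dist hexH x y = 2%N.
    apply: contrapT => /forallNP no2; have [_ + _] := shell_kernel R hexH orderH x.
    rewrite /shell big_pred0 => [|y]; last by apply/eqP; exact: no2.
    by move/eqP; rewrite eq_sym pnatr_eq0.
  have N4 : sqnorm (v x - v y) = 4.
    rewrite sqnormB !(sqnorm_hexagon_vector R hexH orderH).
    rewrite (dot_hexagon_vector R hexH orderH) kernel_dist dxy /=.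
    by field.
  exists (v x - v y); split=> //; first exact: lattice_vectorB.
  by move=> xy0; move: N4; rewrite xy0 /sqnorm dot0l => /eqP; rewrite eq_sym pnatr_eq0.
move=> u Lu u0; have := integral_dual_gap hexH orderH (lattice_integral_dual hexH orderH Lu).
have [k kE] := lattice_even hexH orderH Lu.
have : 0 < sqnorm u.
  by rewrite lt_def sqnorm_ge0 andbT; apply/eqP => /sqnorm_eq0.
move=> N0 gap; have : 7 / 2 <= sqnorm u by nra.
rewrite kE => N7; rewrite (ler_int R 4).
have : (7 <= 2 * (2 * k))%R by rewrite -(ler_int R); move: N7; rewrite !intrM; lra.
by lia.
Qed.

End Determinant.

(** * Recovering the hexagon *)

Section Isomorphism.

Lemma graph_dist_iso (T T' : eqType) (e : rel T) (e' : rel T') h k :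
    cancel h k -> cancel k h -> (forall u w, e' (h u) (h w) = e u w) ->
  forall u w m, graph_dist e u w m -> graph_dist e' (h u) (h w) m.
Proof.
move=> hK kH he u w m [[p [pp lp sp]] min]; split.
  exists (map h p); split; [|by rewrite last_map lp|by rewrite size_map].
  by apply: homo_path pp => x y; rewrite he.
move=> q pq lq; rewrite -(size_map k); apply: min.
  rewrite -(hK u); apply: homo_path pq => x y.
  by rewrite -{1}(kH x) -{1}(kH y) he.
by rewrite -{1}(hK u) last_map lq hK.
Qed.

Lemma graph_diameter_iso (T T' : eqType) (e : rel T) (e' : rel T') h k d :
    cancel h k -> cancel k h -> (forall u w, e' (h u) (h w) = e u w) ->
  graph_diameter e d -> graph_diameter e' d.
Proof.
move=> hK kH he [le_d [x [y xy]]]; split.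
  move=> u w; have [m uw md] := le_d (k u) (k w); exists m => //.
  by rewrite -(kH u) -(kH w); apply: graph_dist_iso uw.
by exists (h x), (h y); apply: graph_dist_iso xy.
Qed.

Lemma ucycle_iso (T T' : eqType) (e : rel T) (e' : rel T') h c :
  injective h -> (forall u w, e' (h u) (h w) = e u w) ->
  ucycle e c -> ucycle e' (map h c).
Proof.
move=> hI he /andP[cc uc]; apply/andP; split; last by rewrite map_inj_uniq.
by apply: homo_cycle cc => x y; rewrite he.
Qed.

Lemma graph_girth_iso (T T' : eqType) (e : rel T) (e' : rel T') h k g :
    cancel h k -> cancel k h -> (forall u w, e' (h u) (h w) = e u w) ->
  graph_girth e g -> graph_girth e' g.
Proof.
move=> hK kH he [[c [uc c2 cg]] min]; split.
  by exists (map h c); rewrite size_map; split=> //; apply: ucycle_iso uc => //; exact: can_inj hK.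
move=> c' uc' c'2; rewrite -(size_map k); apply: min; last by rewrite size_map.
by apply: ucycle_iso uc' => [|u w]; [exact: can_inj kH|rewrite -he !kH].
Qed.

Lemma generalized_hexagon_iso (X Y X' Y' : eqType)
    (inc : X -> Y -> bool) (inc' : X' -> Y' -> bool) :
  geometry_iso inc inc' -> generalized_hexagon inc -> generalized_hexagon inc'.
Proof.
move=> [f [g [[f' fK f'K] [g' gK g'K] fg]]] [diam girth].
pose h (u : X + Y) : X' + Y' := match u with inl x => inl (f x) | inr l => inr (g l) end.
pose k (u : X' + Y') : X + Y := match u with inl x => inl (f' x) | inr l => inr (g' l) end.
have hK : cancel h k by case=> x /=; rewrite ?fK ?gK.
have kH : cancel k h by case=> x /=; rewrite ?f'K ?g'K.
have he u w : incidence_graph inc' (h u) (h w) = incidence_graph inc u w.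
  by case: u => u; case: w => w /=; rewrite ?fg.
by split; [apply: graph_diameter_iso diam|apply: graph_girth_iso girth].
Qed.

End Isomorphism.

(** * Minimal vectors in the class of the generators *)

Section MinimalVectors.
Variables (R : realType) (X Y : finType) (inc : X -> Y -> bool).
Hypothesis hexH : generalized_hexagon inc.
Hypothesis orderH : has_order inc 2 8.

Notation g := (kernel R hexH).
Notation v := (hexagon_vector R inc).
Notation L := (hexagon_lattice R inc).
Notation coef := (@coef R X Y inc).
Notation hspan := (@hspan R X Y inc).
Notation shell := (shell hexH).

Definition vector_class x0 : set 'cV[R]_#|X| := [set v x0 + u | u in L].

Lemma vector_in_class x0 x : vector_class x0 (v x).
Proof. by exists (v x - v x0); [exact: lattice_vectorB|rewrite addrC subrK]. Qed.

Section ClassVector.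
Variables (x0 : X) (w : 'cV[R]_#|X|).
Hypothesis Cw : vector_class x0 w.

Lemma class_hspan : hspan w.
Proof.
have [u Lu <-] := Cw; apply: hspanD; first exact: hspan_vector.
exact: lattice_hspan.
Qed.

Lemma class_coef x : exists m : int, coef w x = 2 / 3 + m%:~R.
Proof.
have [u Lu <-] := Cw; have [_ /(_ x) /intrP[k kE]] := lattice_integral_dual hexH orderH Lu.
have /intrP[j jE] := kernel_mod1 R hexH x0 x.
exists (j + k); rewrite coefD kE coef_vector // rmorphD /= -jE; by field.
Qed.

Lemma class_sqnorm : exists k : int, sqnorm w = 8 / 3 + 2 * k%:~R.
Proof.
have [u Lu <-] := Cw; have [k kE] := lattice_even hexH orderH Lu.
have [_ /(_ x0) /intrP[j jE]] := lattice_integral_dual hexH orderH Lu.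
exists (j + k); rewrite sqnormD dotC -/(coef u x0) jE kE /sqnorm.
by rewrite (dot_hexagon_vector R hexH orderH) kernel_diag; field.
Qed.

(** A smaller norm could only be [2 / 3], giving the second moment [84 * (2 / 3) = 56]. But each of
    the 819 entries is [2 / 3] modulo 1 and has square at least [1 / 9], which makes at least 91. *)
Lemma class_sqnorm_ge : 8 / 3 <= sqnorm w.
Proof.
have [k kE] := class_sqnorm.
have [k0|k0] := leP 0 k; first by rewrite kE lerDl mulr_ge0 ?ler0z.
have k1 : k = -1.
  apply/eqP; rewrite eq_le; apply/andP; split; first by lia.
  have := sqnorm_ge0 w; rewrite kE => N0.
  by have : (-2)%:~R < k%:~R :> R; [lra|rewrite ltr_int; lia].
have := coef_moment2 hexH orderH class_hspan; rewrite kE k1 => M2.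
have : \sum_(x : X) (1 / 9 : R) <= \sum_x coef w x ^+ 2.
  apply: ler_sum => x _; have [m ->] := class_coef x.
  have : 0 <= (m * (3 * m + 4) + 1)%:~R :> R.
    by rewrite ler0z; have [|] := leP 0 m; nia.
  by rewrite !rmorphD !rmorphM /= rmorphD rmorphM /=; lra.
rewrite sumr_const -[_ *+ #|X|]mulr_natr (card_points R hexH orderH) M2; lra.
Qed.

Lemma class_sum_coef : \sum_x coef w x = 0.
Proof.
have zero := coef_line_sum hexH orderH class_hspan.
have [C1 C2 C3] := shell_line_sum0 hexH orderH x0 zero.
by rewrite (sum_shells hexH x0) C1 C2 C3; ring.
Qed.

Hypothesis Nw : sqnorm w = 8 / 3.
Hypothesis w_new : forall x, w <> v x.

(** The norms [16 / 3 - 2 c] and [16 / 3 + 2 c] of [w - v x] and [w + v x] confine [c] to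
    [[- 8 / 3, 8 / 3]]; the upper end means [w = v x], and the lower end is not [2 / 3] modulo 1. *)
Lemma class_coef_values x : [\/ coef w x = - (7 / 3), coef w x = - (4 / 3),
  coef w x = - (1 / 3) | coef w x = 2 / 3] \/ coef w x = 5 / 3.
Proof.
have [m mE] := class_coef x.
have N1 : sqnorm (w - v x) = 16 / 3 - 2 * coef w x.
  by rewrite sqnormB Nw (sqnorm_hexagon_vector R hexH orderH) -/(coef w x); field.
have N2 : sqnorm (w + v x) = 16 / 3 + 2 * coef w x.
  by rewrite sqnormD Nw (sqnorm_hexagon_vector R hexH orderH) -/(coef w x); field.
have := sqnorm_ge0 (w + v x); rewrite N2 mE => ge.
have lt : coef w x < 8 / 3.
  have := sqnorm_ge0 (w - v x); rewrite le_eqVlt => /orP[/eqP/esym/sqnorm_eq0/subr0_eq|].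
    by move/w_new.
  by rewrite N1; lra.
have m2 : (m < 2)%R by rewrite -(ltr_int R); move: lt; rewrite mE; lra.
have m4 : (-4 < m)%R by rewrite -(ltr_int R) rmorphN /=; lra.
have : m = -3 \/ m = -2 \/ m = -1 \/ m = 0 \/ m = 1 by lia.
case=> [|[|[|[|]]]] m_eq; rewrite m_eq.
- by left; constructor 1; field.
- by left; constructor 2; field.
- by left; constructor 3; field.
- by left; constructor 4; field.
- by right; field.
Qed.

Lemma class_coef_neq53 z : coef w z <> 5 / 3.
Proof.
move=> cz; have su := class_hspan.
pose c2 x := coef w x ^+ 2.
have [C1 C2 C3] := shell_line_sum0 hexH orderH z (coef_line_sum hexH orderH su).
have [K1 K2 K3] := shell_kernel R hexH orderH z.
have M2 := coef_moment2 hexH orderH su.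
rewrite (sum_shells hexH z) cz -!/(c2) in M2.
have M22 := coef_moment22 hexH orderH z su.
rewrite (sum_kernel_shells hexH z c2) cz /c2 cz -!/(c2) in M22.
(* The quadratics are [(c + 4 / 3) (c + 1 / 3)] and [(c + 1 / 3) (c - 2 / 3)]: their roots are
   neighbouring admissible values, so they are nonnegative at all entries. They bound the sums of
   squares over the first two shells below by 17 and 104, whereas the moments give
   [15 s1 + 3 s2 = 513] for these sums. *)
have S1 : 0 <= shell z 1 c2 + 5 / 3 * shell z 1 (coef w) + 4 / 9 * shell z 1 (fun=> 1).
  rewrite -!shellZ -!shellD; apply: shell_ge0 => x _; rewrite /c2.
  by have [[]|] := class_coef_values x => ->; lra.
have S2 : 0 <= shell z 2 c2 - 1 / 3 * shell z 2 (coef w) - 2 / 9 * shell z 2 (fun=> 1).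
  rewrite -!mulNr -!shellZ -!shellD; apply: shell_ge0 => x _; rewrite /c2.
  by have [[]|] := class_coef_values x => ->; lra.
by rewrite Nw in M2 M22; lra.
Qed.

(** The other two entries on a line through [z] would sum to [7 / 3], but without [5 / 3] none
    exceeds [2 / 3]. *)
Lemma class_coef_neqN73 z : coef w z <> - (7 / 3).
Proof.
move=> cz; have [y dy] := exists_neighbour hexH orderH z.
have [y' [_ _ /(_ _ (coef_line_sum hexH orderH class_hspan))]] := third_point R orderH dy.
rewrite cz; have [c1|] := class_coef_values y; last by move/class_coef_neq53.
have [c2|] := class_coef_values y'; last by move/class_coef_neq53.
by case: c1 => ->; case: c2 => ->; lra.
Qed.

(* The monic quartic without cubic term that vanishes at the entries left over:
   its sum over all points is determined by the moments, and is not zero. *)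
Lemma class_vector_contradiction : False.
Proof.
(* The root 1 is chosen to cancel the sum [- 1] of the three possible entries. By the moments, the
   sum over all points is [(512 - 1120 + 728) / 3 = 40]. *)
have p0 x : (coef w x + 4 / 3) * (coef w x - 2 / 3) * (coef w x + 1 / 3) * (coef w x - 1) = 0.
  have [[]|] := class_coef_values x => c.
  - by case: (class_coef_neqN73 c).
  - by rewrite c; field.
  - by rewrite c; field.
  - by rewrite c; field.
  - by case: (class_coef_neq53 c).
have M2 := coef_moment2 hexH orderH class_hspan.
have M4 := coef_moment4 hexH orderH class_hspan.
have : \sum_x (coef w x ^+ 4 + (- 5 / 3 * coef w x ^+ 2 + (10 / 27 * coef w x + 8 / 27))) = 0.
  by apply: big1 => x _; rewrite -[RHS](p0 x); field.
rewrite !big_split /= -!mulr_sumr class_sum_coef M2 M4 Nw sumr_const -[_ *+ #|X|]mulr_natr.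
rewrite (card_points R hexH orderH) => /eqP; apply/negP; lra.
Qed.

End ClassVector.

Lemma minimal_vectors_class x0 w : minimal_vectors (vector_class x0) w <-> exists x, w = v x.
Proof.
have Nv := sqnorm_hexagon_vector R hexH orderH.
split=> [[Cw min]|[x ->]]; last first.
  by split=> [|u Cu]; [exact: vector_in_class|rewrite Nv; apply: class_sqnorm_ge Cu].
apply: contrapT => /forallNP w_new.
have Nw : sqnorm w = 8 / 3.
  apply/eqP; rewrite eq_le (class_sqnorm_ge Cw) andbT -(Nv x0).
  by apply: min; exact: vector_in_class.
exact: class_vector_contradiction Cw Nw w_new.
Qed.

End MinimalVectors.

(** * The geometry of the minimal vectors *)

Section Recover.
Variables (R : realType) (X Y : finType) (inc : X -> Y -> bool).
Hypothesis hexH : generalized_hexagon inc.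
Hypothesis orderH : has_order inc 2 8.

Notation g := (kernel R hexH).
Notation v := (hexagon_vector R inc).
Notation L := (hexagon_lattice R inc).

Lemma hexagon_vector_inj : injective v.
Proof.
move=> x y xy; apply/eqP; rewrite -(point_dist_eq0 hexH).
have := kernel_diag R hexH x; rewrite -(dot_hexagon_vector R hexH orderH) {2}xy.
rewrite (dot_hexagon_vector R hexH orderH) kernel_dist.
have := point_dist_le3 hexH x y; clear xy.
by case: point_dist => [|[|[|[|//]]]] _ //= E; exfalso; lra.
Qed.

Lemma line_through_unique x y l m :
  x != y -> inc x l -> inc y l -> inc x m -> inc y m -> l = m.
Proof.
move=> xy xl yl xm ym; have d1 := incident_dist1 hexH xl yl xy.
have [|k yk lev] := @nearest_line _ _ _ hexH x y; first by rewrite d1.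
have near j : inc x j -> inc y j -> j = k.
  move=> xj yj; have := lev _ yj; rewrite line_level_self // d1.
  by case: eqP.
by rewrite (near l) // (near m).
Qed.

(** The product with [v x] gives [8 / 3 + g y x + g z x = 0], possible only if both kernel values
    are [- (4 / 3)]; so [x] and [y] are collinear. The third point of their line has vector
    [- (v x + v y) = v z], hence is [z] by injectivity. *)
Lemma vector_sum0_collinear x y z : v x + v y + v z = 0 ->
  exists2 l, inc x l & inc y l /\ inc z l.
Proof.
move=> s0; have : dot (v x + v y + v z) (v x) = 0 by rewrite s0 dot0l.
rewrite !dotDl !(dot_hexagon_vector R hexH orderH) kernel_diag !kernel_dist.
have collinear_yx : point_dist hexH y x = 1%N \/
  8 / 3 + [:: 8 / 3; - (4 / 3); 2 / 3; - (1 / 3)]`_(point_dist hexH y x) +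
  [:: 8 / 3; - (4 / 3); 2 / 3; - (1 / 3)]`_(point_dist hexH z x) <> 0 :> R.
  have := point_dist_le3 hexH y x; have := point_dist_le3 hexH z x; clear s0.
  by case: point_dist => [|[|[|[|//]]]] _; case: point_dist => [|[|[|[|//]]]] _ /=;
    solve [by left | by right; lra].
case: collinear_yx => // /collinearP /andP[yx /existsP[l /andP[yl xl]]] _.
exists l => //; split=> //.
have [a [b [[al bl xa xb ab] all3 sum3]]] := line_points orderH xl.
have vl : v x + v a + v b = 0.
  apply: (coef_eq0 hexH orderH).
    by apply: hspanD; [apply: hspanD|]; exact: hspan_vector.
  move=> p; rewrite !coefD !coef_vector // -(kernel_line_sum R hexH orderH p l).
  by rewrite sum3 ![g p _]kernel_sym.
have vz : v z = - (v x + v y) by apply/eqP; rewrite -addr_eq0 addrC s0.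
have := all3 y yl; rewrite (negbTE yx) /= => /orP[] /eqP y_eq; rewrite y_eq in vz.
  suff <- : b = z by [].
  by apply: hexagon_vector_inj; rewrite vz; apply/eqP; rewrite -addr_eq0 addrC vl.
suff <- : a = z by [].
by apply: hexagon_vector_inj; rewrite vz; apply/eqP; rewrite -addr_eq0 addrC addrAC vl.
Qed.

Variable x0 : X.
Notation M := (minimal_vectors (@vector_class R X Y inc x0)).

Lemma mem_minimal w : (w \in M) <-> exists x, w = v x.
Proof. by rewrite in_setE; exact: minimal_vectors_class. Qed.

Lemma vector_point_subproof x : v x \in M.
Proof. by apply/mem_minimal; exists x. Qed.

Definition to_vector_point (x : X) : vector_point M := exist _ (v x) (vector_point_subproof x).

Definition line_fset (l : Y) : {fset 'cV[R]_#|X|} :=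
  [fset u in [seq v x | x <- enum X & inc x l]]%fset.

Lemma mem_line_fset x l : (v x \in line_fset l) = inc x l.
Proof.
rewrite !inE; apply/mapP/idP => [[y + /hexagon_vector_inj ->]|xl].
  by rewrite mem_filter => /andP[].
by exists x => //; rewrite mem_filter xl mem_enum.
Qed.

Lemma line_fset_perm x y z l :
  inc x l -> (forall p, inc p l -> [|| p == x, p == y | p == z]) ->
  inc y l -> inc z l -> uniq [:: x; y; z] -> perm_eq (line_fset l) [:: v x; v y; v z].
Proof.
move=> xl all3 yl zl uxyz; apply: uniq_perm; first exact: fset_uniq.
  by rewrite (map_inj_uniq hexagon_vector_inj [:: x; y; z]).
move=> u; rewrite !inE; apply/idP/idP => [/mapP[p + ->]|].
  rewrite mem_filter => /andP[/all3 + _].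
  by case/or3P => /eqP ->; rewrite eqxx ?orbT.
by case/or3P => /eqP ->; apply: map_f; rewrite mem_filter mem_enum ?xl ?yl ?zl.
Qed.

Lemma vector_line_subproof l :
  [&& #|` line_fset l| == 3%N, all (fun u => u \in M) (line_fset l)
    & \sum_(u <- line_fset l) u == 0].
Proof.
have /card_gt0P[x xl] : (0 < #|[pred x | inc x l]|)%N by rewrite orderH.1.
have [a [b [[al bl xa xb ab] all3 sum3]]] := line_points orderH xl.
have uxab : uniq [:: x; a; b] by rewrite /= !inE negb_or xa xb ab.
have pl := line_fset_perm xl all3 al bl uxab.
rewrite (perm_size pl) (perm_all _ pl) (perm_big _ pl) /= !vector_point_subproof /=.
rewrite !big_cons big_nil addr0 addrA; apply/eqP.
apply: (coef_eq0 hexH orderH).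
  by apply: hspanD; [apply: hspanD|]; exact: hspan_vector.
move=> p; rewrite !coefD !coef_vector // -(kernel_line_sum R hexH orderH p l).
by rewrite sum3 ![g p _]kernel_sym.
Qed.

Definition to_vector_line (l : Y) : vector_line M :=
  exist _ (line_fset l) (vector_line_subproof l).

Lemma bij_of_inj_surj (A B : Type) (f : A -> B) :
  injective f -> (forall b, exists a, b = f a) -> bijective f.
Proof.
move=> fI /choice[f' f'K]; exists f' => // a.
by apply: fI; rewrite -f'K.
Qed.

Lemma to_vector_point_bij : bijective to_vector_point.
Proof.
apply: bij_of_inj_surj => [x y /(congr1 sval)/hexagon_vector_inj //|[u uM]].
have [x ux] := (mem_minimal u).1 uM; exists x; exact: val_inj.
Qed.

Lemma to_vector_line_bij : bijective to_vector_line.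
Proof.
apply: bij_of_inj_surj => [l m /(congr1 sval) /= lm|[A Aline]].
  have /card_gt0P[x xl] : (0 < #|[pred x | inc x l]|)%N by rewrite orderH.1.
  have [a [b [[al bl xa xb ab] all3 sum3]]] := line_points orderH xl.
  by apply: (line_through_unique xa xl al); rewrite -mem_line_fset -lm mem_line_fset.
have := Aline => /and3P[/eqP A3 /allP AM /eqP A0].
suff [l Al] : exists l, A = line_fset l by exists l; exact: val_inj.
have uA := fset_uniq A; have memA u : (u \in A) = (u \in (A : seq _)) by [].
case: (A : seq _) A3 AM A0 uA memA => [|u1 [|u2 [|u3 [|//]]]] //= _ AM A0 uA memA.
have mem_v u : u \in [:: u1; u2; u3] -> exists x, u = v x.
  by move=> /AM /mem_minimal.
have [x1 e1] := mem_v u1 (mem_head _ _).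
have [x2 e2] : exists x, u2 = v x by apply: mem_v; rewrite !inE eqxx orbT.
have [x3 e3] : exists x, u3 = v x by apply: mem_v; rewrite !inE eqxx !orbT.
subst u1 u2 u3; rewrite !big_cons big_nil addr0 addrA in A0.
have [l l1 [l2 l3]] := vector_sum0_collinear A0.
exists l; apply/fsetP => u; rewrite memA.
have uniq123 : uniq [:: x1; x2; x3] by rewrite -(map_inj_uniq hexagon_vector_inj).
rewrite -(perm_mem (line_fset_perm l1 _ l2 l3 uniq123)) // => p pl.
have := orderH.1 l.
have sub : [set x1; x2; x3]%SET \subset [set q | inc q l]%SET.
  by apply/fintype.subsetP => q; rewrite !inE => /orP[/orP[]|] /eqP ->.
have card3 : #|[set x1; x2; x3]%SET| = 3%N.
  move: uniq123; rewrite /= !inE negb_or -andbA => /and4P[n12 n13 n23 _].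
  by rewrite -finset.setUA cardsU1 !inE negb_or n12 n13 cards2 n23.
move=> cl; have /eqP E : [set x1; x2; x3]%SET == [set q | inc q l]%SET.
  by rewrite eqEcard sub card3 cardsE cl.
have : p \in [set q | inc q l]%SET by rewrite inE.
by rewrite -E !inE orbA.
Qed.

Lemma recovered_geometry_iso :
  geometry_iso inc (@vector_inc R #|X| M).
Proof.
exists to_vector_point, to_vector_line; split.
- exact: to_vector_point_bij.
- exact: to_vector_line_bij.
- by move=> x l; rewrite /vector_inc /= mem_line_fset.
Qed.

Lemma class_dual : dual_class L (@vector_class R X Y inc x0).
Proof.
exists (v x0) => //; split.
  exists 1%N, (fun=> 3^-1), (fun=> v x0 *~ 3); split=> [_|]; first exact: lattice_vector3.
  by rewrite big_ord1 -scaler_int scalerA mulVf ?scale1r // pnatr_eq0.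
move=> u Lu; have /intrP := (lattice_integral_dual hexH orderH Lu).2 x0.
by rewrite /coef dotC.
Qed.

Lemma class_neq_lattice : @vector_class R X Y inc x0 <> L.
Proof.
move=> CL; have : L (v x0) by rewrite -CL; exact: vector_in_class.
move=> /(lattice_even hexH orderH)[k]; rewrite (sqnorm_hexagon_vector R hexH orderH) => E.
have : (8 : int)%:~R = (3 * (2 * k))%:~R :> R by rewrite intrM -E; field.
by move/intr_inj; lia.
Qed.

End Recover.

Theorem theorem2 (R : realType) (X Y : finType) (inc : X -> Y -> bool)
    (hexH : generalized_hexagon inc) (orderH : has_order inc 2 8) :
  let L : set 'cV[R]_#|X| := hexagon_lattice R inc in
  [/\ is_integral L /\ is_even L,
      lattice_rank L 26,
      lattice_det L 3,
      lattice_min L 4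
    & exists C : set 'cV[R]_#|X|,
        [/\ dual_class L C, C <> L,
            generalized_hexagon (@vector_inc R #|X| (minimal_vectors C))
          & geometry_iso inc (@vector_inc R #|X| (minimal_vectors C))]].
Proof.
have [x0 _] := exists_point hexH orderH; split.
- by split; [exact: (lattice_integral hexH orderH)|exact: (lattice_even hexH orderH)].
- exact: (hexagon_lattice_rank R hexH orderH).
- exact: (hexagon_lattice_det R hexH orderH).
- exact: (hexagon_lattice_min R hexH orderH).
have iso := recovered_geometry_iso R hexH orderH x0.
exists (@vector_class R X Y inc x0); split=> //.
- exact: (class_dual R hexH orderH x0).
- by move=> CL; apply: (class_neq_lattice hexH orderH CL).
- exact: (generalized_hexagon_iso iso hexH).
Qed.
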